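(* Let $X$ be a real or complex Banach space and $U\subset X^*$ a norm-open convex set. Then: (1) $\tilde U=\operatorname{Int}_{\|\cdot\|} U^{(1)}$. (2) $U^{(\widetilde{\alpha})}=\operatorname{Int}_{\|\cdot\|} U^{(\alpha)}$ for each ordinal $\alpha$. (3) Consider the following assertions: (i) $U$ is boundedly regular; (ii) $\tilde{\tilde U}=\tilde U$; (iii) $\tilde U=\operatorname{Int}_{\|\cdot\|}\overline{U}^{w^*}$; (iv) $\overline{U}^{w^*}=\overline{U^{(1)}}^{\|\cdot\|}$. Then assertions (ii), (iii), (iv) are equivalent, and they are implied by (i).
   Context: $\operatorname{Int}_{\|\cdot\|}$, $\overline{\,\cdot\,}^{\|\cdot\|}$ and $\overline{\,\cdot\,}^{w^*}$ denote norm interior, norm closure and weak* closure in $X^*$; $B_{X^*}$ is the open unit ball of $X^*$. For a norm-open set $U\subset X^*$, a subset $B\subset U$ is $U$-bounded if it is bounded and has positive distance to $X^*\setminus U$ (void condition if $U=X^*$). A fundamental sequence (family) of $U$-bounded sets is a sequence $(B_n)_{n\ge1}$ such that each $B_n$ is $U$-bounded, each $U$-bounded set is contained in some $B_n$, and there are $r_n>0$ with $B_n+r_nB_{X^*}\subset B_{n+1}$ for all $n$. The envelope of $U$ is $\tilde U:=\bigcup\{\overline{B}^{w^*}: B \text{ is } U\text{-bounded}\}=\bigcup_n\overline{U_n}^{w^*}$ for any fundamental family $(U_n)$ of $U$-bounded sets; it is norm-open. $U$ is boundedly regular if, for a fundamental family $(U_n)$ of $U$-bounded sets, $(\overline{U_n}^{w^*})_n$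 is a fundamental family of $\tilde U$-bounded sets (this does not depend on the choice of the family). Iterated envelopes: $U^{(\widetilde{0})}=U$, $U^{(\widetilde{\beta+1})}=\widetilde{U^{(\widetilde{\beta})}}$, and $U^{(\widetilde{\alpha})}=\bigcup_{\beta<\alpha}U^{(\widetilde{\beta})}$ for limit ordinals $\alpha$. For any $A\subset X^*$: $A^{(0)}=A$, $A^{(1)}=\bigcup_{n\in\mathbb{N}}\overline{A\cap nB_{X^*}}^{w^*}$, $A^{(\beta+1)}=(A^{(\beta)})^{(1)}$, and $A^{(\alpha)}=\bigcup_{\beta<\alpha}A^{(\beta)}$ for limit ordinals $\alpha$. *)

(* Defs.v *)
From HB Require Import structures.
From mathcomp Require Import all_boot all_order all_algebra.
From mathcomp Require Import all_classical all_reals all_analysis.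
From mathcomp Require Import complex.

Set Implicit Arguments.
Unset Strict Implicit.
Unset Printing Implicit Defensive.

Import Order.TTheory GRing.Theory Num.Theory.
Import numFieldNormedType.Exports.

Local Open Scope classical_set_scope.
Local Open Scope ring_scope.

Variant scalar_kind := RealScalars | ComplexScalars.

Definition scalars (R : realType) (k : scalar_kind) : numFieldType :=
  match k with RealScalars => R | ComplexScalars => R[i] end.

Section Scalars.
Context {R : realType} {k : scalar_kind}.
Local Notation K := (scalars R k).

(* The norm of a normed K-module takes its values in K. These two maps move
   between R and the real elements of K, so that suprema, which exist in R only,
   can be used to define norms. *)
Definition scalar_re : K -> R :=
  match k return scalars R k -> R with
  | RealScalars => fun z => z
  | ComplexScalars => @complex.Re R
  end.

Definition scalar_of_real : R -> K :=
  match k return R -> scalars R k with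
  | RealScalars => fun r => r
  | ComplexScalars => fun r => real_complex R r
  end.

Lemma scalar_of_realK : cancel scalar_of_real scalar_re.
Proof. by rewrite /scalar_of_real /scalar_re; case: k. Qed.

Lemma scalar_reK (z : K) : z \is Num.real -> scalar_of_real (scalar_re z) = z.
Proof.
rewrite /scalar_of_real /scalar_re; case: k z => //= z.
exact: complex.RRe_real.
Qed.

Lemma ler_scalar_of_real (r s : R) :
  (scalar_of_real r <= scalar_of_real s) = (r <= s).
Proof.
by rewrite /scalar_of_real; case: k => //=; rewrite complex.lecR.
Qed.

Lemma scalar_of_realD (r s : R) :
  scalar_of_real (r + s) = scalar_of_real r + scalar_of_real s.
Proof. by rewrite /scalar_of_real; case: k => //=; rewrite raddfD. Qed.

Lemma scalar_of_realM (r s : R) :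
  scalar_of_real (r * s) = scalar_of_real r * scalar_of_real s.
Proof. by rewrite /scalar_of_real; case: k => //=; rewrite rmorphM. Qed.

Lemma scalar_of_real0 : scalar_of_real 0 = 0.
Proof. by rewrite /scalar_of_real; case: k => //=; rewrite raddf0. Qed.

Lemma scalar_norm_reK (V : normedZmodType K) (x : V) :
  scalar_of_real (scalar_re `|x|) = `|x|.
Proof. by rewrite scalar_reK// normr_real. Qed.

End Scalars.

Section Dual.
Context {R : realType} {k : scalar_kind}.
Local Notation K := (scalars R k).
Variable X : normedModType K.

Definition continuous_functional : {pred X -> K^o} :=
  [pred f : X -> K^o | `[< linear f /\ continuous f >]].

Record dual := Dual {
  dual_fun :> X -> K^o;
  dual_funP : dual_fun \in continuous_functional }.

HB.instance Definition _ := [isSub for dual_fun].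
HB.instance Definition _ := [Choice of dual by <:].

Lemma continuous_functional_submod : submod_closed continuous_functional.
Proof.
split=> [|a f g].
  apply/asboolP; split=> [b x y|x]; last exact: cvg_cst.
  by rewrite scaler0 addr0.
move=> /asboolP[lf cf] /asboolP[lg cg]; apply/asboolP; split=> [b x y|x].
  change (a * f (b *: x + y) + g (b *: x + y)
    = b * (a * f x + g x) + (a * f y + g y)).
  rewrite lf lg /=.
  change (a * (b * f x + f y) + (b * g x + g y)
    = b * (a * f x + g x) + (a * f y + g y)).
  by rewrite !mulrDr !mulrA (mulrC a b) addrACA.
by apply: cvgD; [apply: cvgZr; exact: cf|exact: cg].
Qed.

HB.instance Definition _ := GRing.isSubmodClosed.Build K (X -> K^o)
  continuous_functional continuous_functional_submod.
HB.instance Definition _ := [SubChoice_isSubLmodule of dual by <:].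


Implicit Types f g : dual.

Lemma dual_linear f : linear f.
Proof. by case: f => f /= /asboolP[]. Qed.

Lemma dual_continuous f : continuous f.
Proof. by case: f => f /= /asboolP[]. Qed.

Definition dual_norm f : K :=
  scalar_of_real (sup [set scalar_re `|f x| | x in [set x : X | `|x| <= 1]]).

HB.instance Definition _ f :=
  GRing.isLinear.Build K X K^o _ (dual_fun f) (dual_linear f).

Let has_sup_dual_norm f :
  has_sup [set scalar_re `|f x| | x in [set x : X | `|x| <= 1]].
Proof.
split; first by exists (scalar_re `|f 0|), 0 => //=; rewrite normr0.
have /linear_bounded_continuous/linear_boundedP := @dual_continuous f.
move=> /pinfty_ex_gt0[M M0 fM].
exists (scalar_re M) => _ [x /= x1 <-].
rewrite -(@ler_scalar_of_real R k) scalar_norm_reK scalar_reK ?gtr0_real//.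
by rewrite (le_trans (fM x))// ler_piMr// ltW.
Qed.

Lemma dual_norm_le1 f (x : X) : `|x| <= 1 -> `|f x| <= dual_norm f.
Proof.
move=> x1; rewrite -(scalar_norm_reK (f x)) ler_scalar_of_real.
by apply: sup_upper_bound; [exact: has_sup_dual_norm|exists x].
Qed.

Lemma dual_norm_le f (x : X) : `|f x| <= dual_norm f * `|x|.
Proof.
have [->|x0] := eqVneq x 0; first by rewrite raddf0 !normr0 mulr0.
have n0 : 0 < `|x| by rewrite normr_gt0.
rewrite -ler_pdivrMr//.
have -> : `|f x| / `|x| = `|f (`|x|^-1 *: x)|.
  by rewrite linearZ /= normrZ normfV normr_id mulrC.
by apply: dual_norm_le1; rewrite normrZ normfV normr_id mulVf ?normr_eq0.
Qed.

Lemma dual_norm_lub f (c : K) : c \is Num.real ->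
  (forall x : X, `|x| <= 1 -> `|f x| <= c) -> dual_norm f <= c.
Proof.
move=> cr fc; rewrite -(scalar_reK cr) ler_scalar_of_real.
apply: ge_sup; first by case: (has_sup_dual_norm f).
move=> _ [x /= x1 <-].
by rewrite -(@ler_scalar_of_real R k) scalar_norm_reK scalar_reK// fc.
Qed.

Lemma dual_norm_ge0 f : 0 <= dual_norm f.
Proof. by apply: le_trans (dual_norm_le1 f (x := 0) _); rewrite ?normr0. Qed.

Let dual_normD f g : dual_norm (f + g) <= dual_norm f + dual_norm g.
Proof.
apply: dual_norm_lub => [|x x1].
  by rewrite realD// ger0_real// dual_norm_ge0.
change (`|f x + g x| <= dual_norm f + dual_norm g).
by rewrite (le_trans (ler_normD _ _))// lerD// dual_norm_le1.
Qed.

Let dual_normZ_le (a : K) f : dual_norm (a *: f) <= `|a| * dual_norm f.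
Proof.
apply: dual_norm_lub => [|x x1].
  by rewrite ger0_real// mulr_ge0// dual_norm_ge0.
change (`|a * f x| <= `|a| * dual_norm f).
by rewrite normrM ler_wpM2l// dual_norm_le1.
Qed.

Let dual_normZ (a : K) f : dual_norm (a *: f) = `|a| * dual_norm f.
Proof.
have [->|a0] := eqVneq a 0.
  apply/le_anti; rewrite dual_normZ_le normr0 mul0r.
  by rewrite dual_norm_ge0.
apply/le_anti; rewrite dual_normZ_le /=.
rewrite -ler_pdivlMl ?normr_gt0// -normfV.
by rewrite -{1}(scalerK a0 f) dual_normZ_le.
Qed.

Let dual_norm0_eq0 f : dual_norm f = 0 -> f = 0.
Proof.
move=> f0; apply/val_inj/funext => x /=.
apply/eqP; rewrite -normr_le0.
by rewrite (le_trans (dual_norm_le f x))// f0 mul0r.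
Qed.

HB.instance Definition _ := @Lmodule_isNormed.Build K dual
  dual_norm dual_normD dual_normZ dual_norm0_eq0.

End Dual.

Lemma dual_normE (R : realType) (k : scalar_kind)
    (X : normedModType (scalars R k)) (f : dual X) : `|f| = dual_norm f.
Proof. by []. Qed.

Section WeakStar.
Context {R : realType} {k : scalar_kind} {X : normedModType (scalars R k)}.
Local Notation K := (scalars R k).
Implicit Types A B U : set (dual X).

(* The topology of pointwise convergence on X. *)
Definition weak_star :=
  initial_topology (@dual_fun R k X : dual X -> {ptws X -> K^o}).

Definition weak_star_closure A : set (dual X) := closure (A : set weak_star).

(* The U-bounded sets; the last condition says that B has positive distance to
   the complement of U, and is void when U is the whole space. *)
Definition bounded_within U B :=
  [/\ B `<=` U, bounded_set B &
      exists2 d : K, 0 < d & forall f g, B f -> ~ U g -> d <= `|f - g| ].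

(* [ball 0 (r n)] is r_n times the open unit ball of the dual norm. The
   numbering starts at 0 instead of 1, which is immaterial. *)
Definition fundamental_sequence U (B : nat -> set (dual X)) :=
  [/\ forall n, bounded_within U (B n),
      forall A, bounded_within U A -> exists n, A `<=` B n &
      exists2 r : nat -> K, (forall n, 0 < r n) &
        forall n, [set f + g | f in B n & g in ball 0 (r n)] `<=` B n.+1 ].

Definition envelope U : set (dual X) :=
  \bigcup_(B in bounded_within U) weak_star_closure B.

(* Whether the second condition holds does not depend on the choice of the
   fundamental sequence B of bounded sets within U, and some B always exists
   when U is open, so that the existential could be replaced by a universal
   quantifier. *)
Definition boundedly_regular U :=
  exists2 B, fundamental_sequence U B &
    fundamental_sequence (envelope U) (fun n => weak_star_closure (B n)).

(* A^(1); the term of index n = 0 is empty. *)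
Definition weak_star_derived A : set (dual X) :=
  \bigcup_n weak_star_closure (A `&` ball 0 n%:R).

End WeakStar.

Arguments weak_star {R k} X.

(* An ordinal is given by an element [w] of a well-ordered type [W]: it is the
   order type of the initial segment of elements below [w]. *)
Section Transfinite.
Context {d : Order.disp_t} {W : orderType d}.
Implicit Types v w : W.
Local Open Scope order_scope.

Definition ordinal_zero w := forall v, ~ v < w.

Definition ordinal_succ v w := v < w /\ forall u, u < w -> u <= v.

Definition ordinal_limit w :=
  ~ ordinal_zero w /\ forall v, v < w -> exists2 u, v < u & u < w.

Lemma ordinal_cases w :
  [\/ ordinal_zero w, exists v, ordinal_succ v w | ordinal_limit w].
Proof.
have [w0|w0] := pselect (ordinal_zero w); first exact: Or31.
have [ws|ws] := pselect (exists v, ordinal_succ v w); first exact: Or32.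
apply: Or33; split=> // v vw; apply: contra_notP ws => nu.
exists v; split=> // u uw; rewrite leNgt; apply/negP => vu.
by apply: nu; exists u.
Qed.

Variable wf : well_founded (fun v w : W => v < w).

Section Iterate.
Context {T : Type}.
Variables (step : set T -> set T) (A : set T).

Definition transfinite_body w (rec : forall v, v < w -> set T) : set T :=
  [set x | [\/ ordinal_zero w /\ A x,
     exists v (vw : v < w), ordinal_succ v w /\ step (rec v vw) x |
     ordinal_limit w /\ exists v (vw : v < w), rec v vw x] ].

(* The value at [w] is the iterate of [step] on [A] indexed by the ordinal [w]:
   see [transfinite_zero], [transfinite_succ] and [transfinite_limit]. *)
Definition transfinite : W -> set T := Fix wf (fun=> set T) transfinite_body.

Lemma transfiniteE w :
  transfinite w = transfinite_body (fun v (_ : v < w) => transfinite v).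
Proof.
apply: (Fix_eq wf (fun=> set T) transfinite_body) => v f g fg.
congr transfinite_body; apply: functional_extensionality_dep => u.
exact: functional_extensionality_dep.
Qed.

Lemma transfinite_zero w : ordinal_zero w -> transfinite w = A.
Proof.
move=> w0; rewrite transfiniteE; apply/seteqP; split=> x.
  by case=> [[]|[v [vw _]]|[[]]]// ; have := w0 v vw.
by move=> Ax; apply: Or31.
Qed.

Lemma transfinite_succ v w :
  ordinal_succ v w -> transfinite w = step (transfinite v).
Proof.
move=> vw; rewrite transfiniteE; apply/seteqP; split=> x.
  case=> [[w0 _]|[u [uw [wu Sx]]]|[[_ wl] _]].
  - by have := w0 _ vw.1.
  - suff -> : v = u by [].
    by apply/le_anti; rewrite (vw.2 _ uw) (wu.2 _ vw.1).
  - have [u vu uw] := wl _ vw.1.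
    by have := lt_le_trans vu (vw.2 _ uw); rewrite ltxx.
by move=> Sx; apply: Or32; exists v, vw.1.
Qed.

Lemma transfinite_limit w : ordinal_limit w ->
  transfinite w = \bigcup_(v in [set v | v < w]) transfinite v.
Proof.
move=> wl; rewrite transfiniteE; apply/seteqP; split=> x.
  case=> [[w0 _]|[u [uw [wu Sx]]]|[_ [v [vw Ax]]]].
  - by have := wl.1 w0.
  - have [t ut tw] := wl.2 _ uw.
    by have := lt_le_trans ut (wu.2 _ tw); rewrite ltxx.
  - by exists v.
by move=> [v /= vw Ax]; apply: Or33; split=> //; exists v, vw.
Qed.

End Iterate.
End Transfinite.

(* Main.v *)
Require Import Defs.
From HB Require Import structures.
From mathcomp Require Import all_boot all_order all_algebra.
From mathcomp Require Import all_classical all_reals all_analysis.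
From mathcomp Require Import complex.
From mathcomp Require Import ring lra.

Set Implicit Arguments.
Unset Strict Implicit.
Unset Printing Implicit Defensive.

Import Order.TTheory GRing.Theory Num.Theory.
Import numFieldNormedType.Exports.

Local Open Scope classical_set_scope.
Local Open Scope ring_scope.

(* If [u] is interior to a convex set [A] and [f] is a weak* limit of a bounded part
   of [A], then contracting that part towards [u] makes it bounded within the
   interior of [A], so that [(1 - s) f + s u] lies in the envelope of the interior.
   A point [f] interior to [A^(1)] is of this form: extend the segment from [u]
   beyond [f] inside [A^(1)]. Hence the envelope of the interior of [A] is the
   interior of [A^(1)], which gives (1) and, by transfinite induction, (2). In (3)
   the hard implication is from (ii) to (iii): the contraction shows that the norm
   closure of [U^(1)] contains the weak* limits of its bounded parts, and then the
   Krein-Smulian theorem makes it weak* closed. Krein-Smulian is proved from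
   Banach-Alaoglu and a Hahn-Banach separation of a convex set of null sequences
   from the unit ball. *)

(** * The Hahn-Banach theorem *)

Lemma convex_setP (K : numDomainType) (V : lmodType K) (A : set V) :
  convex_set A <-> forall x y (t : K), A x -> A y -> 0 <= t -> t <= 1 ->
    A (t *: x + (1 - t) *: y).
Proof.
split=> [cA x y t /mem_set Ax /mem_set Ay t0 t1|cA x y l /set_mem Ax /set_mem Ay].
  have := cA x y (Itv01 t0 t1) Ax Ay.
  by move/set_mem.
by apply/mem_set; apply: cA.
Qed.

Section HahnBanach.
Context {R : realType} {V : lmodType R}.
Implicit Types (p q : V -> R) (C : set V).

(** The second inequality, applied to both [t] and [t^-1], already gives equality. *)
Definition sublinear p :=
  (forall x y, p (x + y) <= p x + p y) /\
  (forall t x, 0 < t -> p (t *: x) <= t * p x).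

Lemma sublinear0 p : sublinear p -> p 0 = 0.
Proof.
move=> [pD pZ]; apply/le_anti/andP; split.
  have := pZ 2^-1 0; rewrite scaler0 invr_gt0 ltr0n => /(_ isT); lra.
by have := pD 0 0; rewrite addr0; lra.
Qed.

Lemma sublinear_ge0Z p t x : sublinear p -> 0 <= t -> p (t *: x) = t * p x.
Proof.
move=> sp; rewrite le_eqVlt => /predU1P[<-|t0].
  by rewrite scale0r mul0r sublinear0.
apply/le_anti; rewrite sp.2//= -ler_pdivlMl//.
by apply: le_trans (sp.2 _ _ _); rewrite ?invr_gt0// scalerA mulVf ?scale1r ?gt_eqF.
Qed.

Lemma sublinear_opp_ge p x : sublinear p -> - p (- x) <= p x.
Proof.
by move=> sp; have := sp.1 x (- x); rewrite subrr sublinear0// -lerBlDr sub0r.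
Qed.

(** Directedness puts one [s] below both [q] and [r], whence subadditivity; the lower bound
    [- p (- x)] makes the infima finite. *)
Lemma inf_sublinear (F : set (V -> R)) p : F !=set0 ->
  (forall q, F q -> sublinear q) ->
  (forall q r, F q -> F r -> exists2 s, F s & forall x, s x <= q x /\ s x <= r x) ->
  (forall q, F q -> forall x, - p (- x) <= q x) ->
  sublinear (fun x => inf [set q x | q in F]).
Proof.
move=> [q0 Fq0] sF dF pF.
have lbF x : has_lbound [set q x | q in F].
  by exists (- p (- x)) => _ [q Fq <-]; exact: pF.
have leF q x : F q -> inf [set q x | q in F] <= q x.
  by move=> Fq; apply: ge_inf => //; exists q.
have geinf m x : (forall q, F q -> m <= q x) -> m <= inf [set q x | q in F].
  by move=> mq; apply: lb_le_inf; [exists (q0 x), q0|move=> _ [q Fq <-]; exact: mq].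
split=> [x y|t x t0] /=.
  rewrite -lerBlDr; apply: (geinf) => q Fq; rewrite lerBlDr -lerBlDl.
  apply: (geinf) => r Fr; rewrite lerBlDl.
  have [s Fs sqr] := dF _ _ Fq Fr.
  apply: le_trans (leF _ _ Fs) _; apply: le_trans ((sF _ Fs).1 _ _) _.
  by rewrite lerD//; [exact: (sqr x).1|exact: (sqr y).2].
rewrite -ler_pdivrMl//; apply: (geinf) => q Fq; rewrite ler_pdivrMl//.
by apply: le_trans (leF _ _ Fq) _; exact: (sF _ Fq).2.
Qed.

(* The largest sublinear functional below [p] that is at most [- c] on [- C]. *)
Definition tilt p C (c : R) (x : V) :=
  inf [set p (x + ta.1 *: ta.2) - ta.1 * c |
       ta in [set ta : R * V | 0 <= ta.1 /\ C ta.2]].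

Section Tilt.
Variables (p : V -> R) (C : set V) (c : R).
Hypotheses (sp : sublinear p) (cC : convex_set C) (C0 : C !=set0)
  (pC : forall a, C a -> c <= p a).

Lemma tilt_le x t a : 0 <= t -> C a -> tilt p C c x <= p (x + t *: a) - t * c.
Proof.
move=> t0 Ca; apply: ge_inf; last by exists (t, a).
(* A lower bound for the set: [s * c <= p (s *: b) <= p (x + s *: b) + p (- x)]. *)
exists (- p (- x)) => _ [[s b] /= [s0 Cb] <-].
have := sp.1 (x + s *: b) (- x); rewrite addrAC subrr add0r sublinear_ge0Z//.
have := ler_wpM2l s0 (pC Cb); lra.
Qed.

Lemma tilt_ge x m :
  (forall t a, 0 <= t -> C a -> m <= p (x + t *: a) - t * c) -> m <= tilt p C c x.
Proof.
move=> mp; have [a Ca] := C0; apply: lb_le_inf.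
  by exists (p (x + 0 *: a) - 0 * c), (0, a).
by move=> _ [[t b] /= [t0 Cb] <-]; exact: mp.
Qed.

Lemma tilt_le_id x : tilt p C c x <= p x.
Proof.
have [a Ca] := C0; apply: le_trans (tilt_le x (lexx 0) Ca) _.
by rewrite scale0r addr0 mul0r subr0.
Qed.

Lemma tilt_opp a : C a -> tilt p C c (- a) <= - c.
Proof.
move=> Ca; apply: le_trans (tilt_le (- a) ler01 Ca) _.
by rewrite scale1r addNr sublinear0// mul1r sub0r.
Qed.

Lemma tilt_sublinear : sublinear (tilt p C c).
Proof.
split=> [x y|t x t0].
  rewrite -lerBlDr; apply: tilt_ge => s a s0 Ca; rewrite lerBlDr -lerBlDl.
  apply: tilt_ge => t b t0 Cb; rewrite lerBlDl.
  have := s0; rewrite le_eqVlt => /predU1P[<-|s1].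
    rewrite scale0r addr0 mul0r subr0.
    apply: le_trans (tilt_le _ t0 Cb) _.
    by rewrite -addrA; have := sp.1 x (y + t *: b); lra.
  have st0 : 0 < s + t by rewrite ltr_pwDl.
  (* Convexity of [C] merges [s *: a + t *: b] into [s + t] times a single point of [C]. *)
  pose u := s / (s + t).
  have u0 : 0 <= u by rewrite divr_ge0// ltW.
  have u1 : u <= 1 by rewrite ler_pdivrMr// mul1r lerDl.
  have Cab := (convex_setP C).1 cC a b u Ca Cb u0 u1.
  apply: le_trans (tilt_le _ (ltW st0) Cab) _.
  have -> : (s + t) *: (u *: a + (1 - u) *: b) = s *: a + t *: b.
    rewrite scalerDr !scalerA mulrBr mulr1 /u mulrC divfK ?gt_eqF//.
    by rewrite addrAC subrr add0r.
  by rewrite addrACA; have := sp.1 (x + s *: a) (y + t *: b); lra.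
rewrite -ler_pdivrMl//; apply: tilt_ge => s a s0 Ca; rewrite ler_pdivrMl//.
apply: le_trans (tilt_le _ (mulr_ge0 (ltW t0) s0) Ca) _.
by rewrite -scalerA -scalerDr sublinear_ge0Z ?(ltW t0)// mulrBr mulrA.
Qed.

End Tilt.

(** Zorn's lemma for the reversed pointwise order: a nonempty chain is bounded by its pointwise
    infimum, the empty one by [q]. *)
Lemma minimal_sublinear q : sublinear q ->
  exists p, [/\ sublinear p, forall x, p x <= q x &
    forall p', sublinear p' -> (forall x, p' x <= p x) -> p' = p].
Proof.
move=> sq; pose P p := `[< sublinear p /\ forall x, p x <= q x >].
pose T := {p : V -> R | P p}.
have TP (p : T) : sublinear (val p) /\ forall x, val p x <= q x.
  by case: p => p /= /asboolP.
pose le (p r : T) := `[< forall x, val r x <= val p x >].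
have [|||A tA|p pmin] := @Zorn T le.
- by move=> p; apply/asboolP.
- move=> p r s /asboolP pr /asboolP rs; apply/asboolP => x.
  exact: le_trans (rs x) (pr x).
- move=> p r /asboolP pr /asboolP rp; apply/val_inj/funext => x.
  by apply/le_anti; rewrite pr rp.
- have [->|/set0P[p0 Ap0]] := eqVneq A set0; last first.
    pose F := [set val r | r in A].
    have F0 : F !=set0 by exists (val p0), p0.
    have sF r : F r -> sublinear r by move=> [s _ <-]; exact: (TP s).1.
    have qF r : F r -> forall x, - q (- x) <= r x.
      move=> [s _ <-] x; apply: le_trans (sublinear_opp_ge x (TP s).1).
      by rewrite lerN2 (TP s).2.
    have dF r s : F r -> F s ->
        exists2 u, F u & forall x, u x <= r x /\ u x <= s x.
      move=> [r' Ar <-] [s' As <-].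
      have [/asboolP h|/asboolP h] := tA _ _ Ar As.
        by exists (val s') => [|x]; [exists s'|split].
      by exists (val r') => [|x]; [exists r'|split].
    have si := inf_sublinear F0 sF dF qF.
    have leF r x : A r -> inf [set s x | s in F] <= val r x.
      move=> Ar; apply: ge_inf; last by exists (val r) => //; exists r.
      by exists (- q (- x)) => _ [s Fs <-]; exact: qF.
    have iq : sublinear (fun x => inf [set r x | r in F]) /\
        forall x, inf [set r x | r in F] <= q x.
      by split=> // x; exact: le_trans (leF p0 x Ap0) ((TP p0).2 x).
    exists (exist P _ (asboolT iq)) => r Ar.
    by apply/asboolP => x /=; exact: leF.
  by exists (exist P q (asboolT (conj sq (fun x => lexx (q x))))).
- exists (val p); have [sp pq] := TP p; split=> // r sr rp.
  have rq : sublinear r /\ forall x, r x <= q x.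
    by split=> // x; exact: le_trans (rp x) (pq x).
  rewrite -(pmin (exist P r (asboolT rq)))//; exact/asboolP.
Qed.

(** A minimal sublinear [f] below the tilt of [p] is linear: tilting [f] along a singleton [[set z]]
    at height [f z] gives nothing smaller, so [f (- z) <= - f z]. The tilt of [p] itself forces
    [c <= f a] on [C]. *)
Theorem hahn_banach_convex p C c : sublinear p -> convex_set C -> C !=set0 ->
  (forall a, C a -> c <= p a) ->
  exists f : V -> R, [/\ linear (f : V -> R^o), forall x, f x <= p x &
    forall a, C a -> c <= f a].
Proof.
move=> sp cC C0 pC.
have [f [sf fp fmin]] := minimal_sublinear (tilt_sublinear sp cC C0 pC).
have fN z : f (- z) = - f z.
  apply/le_anti/andP; split; last by have := sublinear_opp_ge (- z) sf; rewrite opprK.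
  have c1 : convex_set [set z].
    apply/convex_setP => _ _ t -> -> _ _ /=.
    by rewrite -scalerDl addrC subrK scale1r.
  have z0 : [set z] !=set0 by exists z.
  have fz a : [set z] a -> f z <= f a by move=> ->.
  have := tilt_opp sf fz (erefl : [set z] z).
  by rewrite (fmin _ (tilt_sublinear sf c1 z0 fz) (tilt_le_id sf z0 fz)).
have fD x y : f (x + y) = f x + f y.
  apply/le_anti; rewrite sf.1/=.
  have := sf.1 (x + y) (- y); rewrite addrK fN; lra.
have fZ t x : f (t *: x) = t * f x.
  have [t0|/ltW t0] := leP 0 t; first by rewrite sublinear_ge0Z.
  by rewrite -{1}(opprK t) scaleNr fN sublinear_ge0Z ?oppr_ge0// mulNr opprK.
exists f; split=> [t x y|x|a Ca].
- by rewrite fD fZ.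
- exact: le_trans (fp x) (tilt_le_id sp C0 pC x).
- have := le_trans (fp (- a)) (tilt_opp sp pC Ca).
  by rewrite fN lerN2.
Qed.

End HahnBanach.

(** * Separation in the space of bounded real sequences *)

Section BoundedSequences.
Context {R : realType}.

Definition bounded_sequence : {pred nat -> R} :=
  [pred y : nat -> R | `[< exists M, forall n, `|y n| <= M >]].

Lemma bounded_sequence_submod : submod_closed bounded_sequence.
Proof.
split=> [|a y z]; first by apply/asboolP; exists 0 => n; rewrite normr0.
move=> /asboolP[M yM] /asboolP[N zN]; apply/asboolP.
exists (`|a| * M + N) => n; apply: le_trans (ler_normD _ _) _.
by rewrite lerD// normrM ler_wpM2l.
Qed.

HB.instance Definition _ := GRing.isSubmodClosed.Build R (nat -> R)
  bounded_sequence bounded_sequence_submod.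

Record bseq := BSeq { bseq_fun :> nat -> R; bseqP : bseq_fun \in bounded_sequence }.

HB.instance Definition _ := [isSub for bseq_fun].
HB.instance Definition _ := [Choice of bseq by <:].
HB.instance Definition _ := [SubChoice_isSubLmodule of bseq by <:].


(** The supremum of the positive part of [y]: a linear functional below it is positive and has norm
    at most 1. *)
Definition bsup (y : bseq) : R := Num.max 0 (sup (range y)).

Let has_sup_bseq (y : bseq) : has_sup (range y).
Proof.
split; first by exists (y 0%N), 0%N.
by have /asboolP[M yM] := bseqP y; exists M => _ [n _ <-]; exact: le_trans (ler_norm _) (yM n).
Qed.

Lemma bsup_ub (y : bseq) n : y n <= bsup y.
Proof.
rewrite le_max; apply/orP; right; apply: sup_upper_bound; last by exists n.
exact: has_sup_bseq.
Qed.

Lemma bsup_le (y : bseq) M : 0 <= M -> (forall n, y n <= M) -> bsup y <= M.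
Proof.
move=> M0 yM; rewrite ge_max M0/=; apply: ge_sup; first by exists (y 0%N), 0%N.
by move=> _ [n _ <-].
Qed.

Lemma bsup_ge0 (y : bseq) : 0 <= bsup y.
Proof. by rewrite le_max lexx. Qed.

Lemma bsup_sublinear : sublinear bsup.
Proof.
split=> [y z|t y t0].
  by apply: bsup_le => [|n]; rewrite ?addr_ge0 ?bsup_ge0// lerD// bsup_ub.
apply: bsup_le => [|n]; first by rewrite mulr_ge0 ?bsup_ge0// ltW.
by rewrite ler_wpM2l ?bsup_ub// ltW.
Qed.

(* [l] is the part in l^1 of a functional on l^oo that separates [C] from the
   unit ball; the tail of [y] bounds the contribution of the singular part. *)
Lemma l1_separation (C : set (nat -> R)) : convex_set C ->
  (forall y, C y -> exists M : R, forall n, `|y n| <= M) ->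
  (forall y, C y -> exists n, 1 <= y n) ->
  exists l : nat -> R, [/\ forall n, 0 <= l n,
    forall N, \sum_(n < N) l n <= 1 &
    forall y N (e : R), C y -> 0 <= e -> (forall n, (N <= n)%N -> `|y n| <= e) ->
      1 - e <= \sum_(n < N) l n * y n].
Proof.
move=> cC bC gC; have [->|/set0P[y0 Cy0]] := eqVneq C set0.
  by exists (fun=> 0); split=> // N; rewrite big1.
pose D := [set y : bseq | C y].
have bs y : (exists M, forall n, `|y n| <= M) -> y \in bounded_sequence.
  by move=> ?; apply/asboolP.
have [f [lf fp fD]] : exists f : bseq -> R, [/\ linear (f : bseq -> R^o),
    forall y, f y <= bsup y & forall y, D y -> 1 <= f y].
  apply: hahn_banach_convex; first exact: bsup_sublinear.
  - apply/convex_setP => y z t Cy Cz t0 t1; exact: ((convex_setP C).1 cC).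
  - by exists (BSeq (bs _ (bC _ Cy0))).
  - by move=> y /gC[n yn]; exact: le_trans yn (bsup_ub _ _).
pose F := GRing.isLinear.Build R bseq R^o _ (f : bseq -> R^o) lf.
pose g : {linear bseq -> R^o} := HB.pack (f : bseq -> R^o) F.
have tP (y : nat -> R) N : (fun n => if (n < N)%N then y n else 0) \in bounded_sequence.
  apply/asboolP; exists (\sum_(i < N) `|y i|) => n.
  case: ifPn => nN; last by rewrite normr0 sumr_ge0.
  by rewrite (bigD1 (Ordinal nN))//= lerDl sumr_ge0.
pose tr y N : bseq := BSeq (tP y N).
have eP i : (fun n => (n == i)%:R : R) \in bounded_sequence.
  by apply/asboolP; exists 1 => n; case: eqP; rewrite ?normr1 ?normr0.
pose e i : bseq := BSeq (eP i).
have gtr y N : g (tr y N) = \sum_(n < N) g (e n) * y n.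
  have -> : tr y N = \sum_(n < N) y n *: e n.
    apply/val_inj; rewrite raddf_sum/=; apply/funext => n.
    rewrite fct_sumE /=; case: ifPn => nN.
      rewrite (bigD1 (Ordinal nN))//= big1 => [|i].
        by rewrite addr0 -[RHS]/(y n * (n == n)%:R) eqxx mulr1.
      rewrite -val_eqE/= => ni.
      by rewrite -[LHS]/(y i * (n == i)%:R) eq_sym (negbTE ni) mulr0.
    rewrite big1// => i _; rewrite -[LHS]/(y i * (n == i)%:R).
    by rewrite gtn_eqF ?mulr0// (leq_trans (ltn_ord i))// leqNgt.
  rewrite linear_sum; apply: eq_bigr => i _.
  by rewrite linearZ/= mulrC.
have gN (y : bseq) m : 0 <= m -> (forall n, - m <= y n) -> - m <= g y.
  move=> m0 my; rewrite lerNl -raddfN; apply: le_trans (fp _) _.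
  by apply: bsup_le => // n; rewrite lerNl.
exists (fun n => g (e n)); split=> [n|N|y N d Cy d0 yd].
- by rewrite -[leLHS]oppr0; apply: gN => // i; rewrite oppr0 /= ler0n.
(* The partial sum is [g] at the truncated constant sequence 1, where [bsup] is at most 1. *)
- under eq_bigr => n _ do rewrite -(mulr1 (g (e n))).
  rewrite -(gtr (fun=> 1)); apply: le_trans (fp _) _.
  by apply: bsup_le => // n /=; case: ifP.
- rewrite -gtr lerBlDl.
  pose y' := BSeq (bs _ (bC _ Cy)).
  apply: le_trans (fD y' Cy) _.
  rewrite -[f y']/(g y') -lerBlDr -raddfB; apply: le_trans (fp _) _.
  (* [y] minus its truncation vanishes below [N] and is at most [d] from there on. *)
  apply: bsup_le => // n; rewrite -[leLHS]/(y n - (if (n < N)%N then y n else 0)).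
  case: ltnP => nN; first by rewrite subrr.
  by rewrite subr0; exact: le_trans (ler_norm _) (yd n nN).
Qed.

End BoundedSequences.

(** * The weak* topology *)

(** For [A] in a finer filter, [F] contains the preimage of [A] or of its complement; the latter
    would put two disjoint sets in that filter. *)
Lemma ultra_fmap (S T : Type) (f : S -> T) (F : set_system S) :
  UltraFilter F -> UltraFilter (f @ F).
Proof.
move=> FU; have FF : ProperFilter F by exact: ultra_proper.
split=> [|G GF FG]; first exact: fmap_proper_filter.
apply/seteqP; split=> [A GA|]; last exact: FG.
have [//|nA] := in_ultra_setVsetC (f @^-1` A) FU.
have /FG GnA : (f @ F) (~` A) by [].
by have [y []] := filter_ex (filterI GA GnA).
Qed.

Lemma closed_norm_le (K : numFieldType) (V : normedModType K) (M : K) :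
  M \is Num.real -> closed [set x : V | `|x| <= M].
Proof.
move=> Mr x clx /=; rewrite real_leNgt ?normr_real//; apply/negP => Mx.
have e0 : 0 < `|x| - M by rewrite subr_gt0.
have [y /= [yM]] := clx _ (nbhsx_ballx x _ e0).
rewrite -ball_normE /= ltrBrDr => xy.
suff /le_lt_trans/(_ xy) : `|x| <= `|x - y| + M by rewrite ltxx.
by apply: le_trans (lerD (lexx _) yM); rewrite -{1}(subrK y x) ler_normD.
Qed.

Lemma compact_scalar_ball (R : realType) (k : scalar_kind) (M : scalars R k) :
  M \is Num.real -> compact [set z : (scalars R k)^o | `|z| <= M].
Proof.
move=> Mr; pose m := scalar_re M.
have cS := @segment_compact R (- m) m.
have cl := closed_norm_le (V := (scalars R k)^o) Mr.
case: k M Mr @m cS cl => /= M Mr cS cl.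
  suff <- : `[- M, M]%classic = [set z : R^o | `|z| <= M] by [].
  by apply/seteqP; split=> z /=; rewrite in_itv/= ler_norml.
set m := complex.Re M in cS.
(* The complex disc is a closed subset of the image of a square under the continuous map [h]. *)
pose h (p : R * R) : R[i]^o := complex.Complex p.1 p.2.
have hc : continuous h.
  move=> p; apply: ((@cvgrPdist_lt R[i] R[i]^o _ (nbhs p) _ h (h p)).2) => e e0.
  have e2 : 0 < complex.Re e / 2.
    by move: e0; rewrite complex.ltcE/= => /andP[_ ?]; rewrite divr_gt0.
  have : \forall q \near p, ball p (complex.Re e / 2) q by exact: nbhsx_ballx.
  apply: filterS => q [/=]; rewrite -ball_normE /= => p1 p2.
  have -> : h p - h q = complex.Complex (p.1 - q.1) (p.2 - q.2) by [].
  rewrite complex.normc_def complex.ltcE /= (complex.ger0_Im (ltW e0)) eqxx /=.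
  apply: le_lt_trans (_ : `|p.1 - q.1| + `|p.2 - q.2| < _); last by lra.
  rewrite -[leRHS]ger0_norm ?addr_ge0// -sqrtr_sqr ler_wsqrtr//.
  rewrite -(real_normK (num_real (p.1 - q.1))) -(real_normK (num_real (p.2 - q.2))).
  have := mulr_ge0 (normr_ge0 (p.1 - q.1)) (normr_ge0 (p.2 - q.2)); nra.
apply: (subclosed_compact cl (B := h @` (`[- m, m] `*` `[- m, m]))).
  apply: continuous_compact; last exact: compact_setX.
  exact: continuous_subspaceT.
move=> z /= zM; exists (complex.Re z, complex.Im z); last by case: z {zM}.
have := zM; rewrite complex.normc_def complex.lecE /= => /andP[_ zm].
rewrite /= !in_itv/= -!ler_norml; split; apply: le_trans zm.
  by rewrite -sqrtr_sqr ler_wsqrtr// lerDl sqr_ge0.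
by rewrite -sqrtr_sqr ler_wsqrtr// lerDr sqr_ge0.
Qed.

Section ScalarRe.
Context {R : realType} {k : scalar_kind}.
Local Notation K := (scalars R k).
Implicit Types z w : K.

Lemma scalar_reD z w : scalar_re (z + w) = scalar_re z + scalar_re w.
Proof. by rewrite /scalar_re; case: k z w => //= z w; rewrite raddfD. Qed.

Lemma scalar_reMl (r : R) z : scalar_re (scalar_of_real r * z) = r * scalar_re z.
Proof.
rewrite /scalar_re /scalar_of_real; case: k z => //= -[a b] /=.
by rewrite mul0r subr0.
Qed.

Lemma scalar_reN z : scalar_re (- z) = - scalar_re z.
Proof. by rewrite /scalar_re; case: k z => //= z; rewrite raddfN. Qed.

Lemma norm_scalar_re_le z : `|scalar_re z| <= scalar_re `|z|.
Proof.
rewrite /scalar_re; case: k z => //= z.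
by rewrite -complex.lecR (le_trans (complex.normc_ge_Re z))// complex.RRe_real ?normr_real.
Qed.

Lemma scalar_of_real1 : scalar_of_real 1 = 1 :> K.
Proof. by rewrite /scalar_of_real; case: k. Qed.

Lemma scalar_re1 : scalar_re (1 : K) = 1.
Proof. by rewrite -scalar_of_real1 scalar_of_realK. Qed.

Lemma scalar_of_real_nat n : scalar_of_real n%:R = n%:R :> K.
Proof. by rewrite /scalar_of_real; case: k => //=; rewrite rmorph_nat. Qed.

Lemma scalar_re_le z w : z \is Num.real -> w \is Num.real ->
  (scalar_re z <= scalar_re w) = (z <= w).
Proof. by move=> zr wr; rewrite -(@ler_scalar_of_real R k) !scalar_reK. Qed.

Lemma ltr_scalar_of_real (r s : R) :
  (scalar_of_real r < scalar_of_real s :> K) = (r < s).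
Proof.
rewrite !lt_def ler_scalar_of_real; congr (~~ _ && _).
by rewrite (inj_eq (can_inj scalar_of_realK)).
Qed.

Lemma scalar_of_real_gt0 (r : R) : (0 < scalar_of_real r :> K) = (0 < r).
Proof. by rewrite -scalar_of_real0 ltr_scalar_of_real. Qed.

Lemma normr_scalar_of_real (r : R) : `|scalar_of_real r| = scalar_of_real `|r| :> K.
Proof.
have ge0 (s : R) : 0 <= s -> `|scalar_of_real s| = scalar_of_real s :> K.
  by move=> s0; rewrite ger0_norm// -scalar_of_real0 ler_scalar_of_real.
have [r0|/ltW r0] := leP 0 r; first by rewrite ge0// ger0_norm.
have -> : scalar_of_real r = - scalar_of_real (- r) :> K.
  by apply/eqP; rewrite -addr_eq0 -scalar_of_realD subrr scalar_of_real0.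
by rewrite normrN ge0 ?oppr_ge0// ler0_norm.
Qed.

Lemma rotate_to_norm z : exists2 u : K, `|u| = 1 & u * z = `|z|.
Proof.
have [->|z0] := eqVneq z 0; first by exists 1; rewrite ?normr1// mulr0 normr0.
exists (`|z| / z); last by rewrite divfK.
by rewrite normrM normfV normr_id divff ?normr_eq0.
Qed.

Lemma scalar_re_continuous : continuous (scalar_re : K^o -> R^o).
Proof.
move=> z; apply: ((@cvgrPdist_lt R R^o K^o (nbhs (z : K^o)) _ scalar_re (scalar_re z)).2).
move=> e e0.
have e0' : 0 < scalar_of_real e :> K by rewrite scalar_of_real_gt0.
have : \forall w \near (z : K^o), ball (z : K^o) (scalar_of_real e) w by exact: nbhsx_ballx.
apply: filterS => w; rewrite -ball_normE /= => zw.
rewrite -scalar_reN -scalar_reD; apply: le_lt_trans (norm_scalar_re_le _) _.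
by rewrite -ltr_scalar_of_real scalar_norm_reK.
Qed.

End ScalarRe.

Section WeakStarTopology.
Context {R : realType} {k : scalar_kind} {X : normedModType (scalars R k)}.
Local Notation K := (scalars R k).
Implicit Types (A B : set (dual X)) (f g : dual X).

Lemma weak_star_cvgP (F : set_system (dual X)) f : Filter F ->
  (F --> (f : weak_star X)) <->
  (forall x, (fun g : dual X => g x : K^o) @ F --> (f x : K^o)).
Proof.
move=> FF; split=> [Ff x|Ff].
  have h : (@dual_fun R k X : dual X -> {ptws X -> K^o}) @ F --> (dual_fun f : {ptws X -> K^o}).
    apply: cvg_trans (@initial_continuous _ _ (@dual_fun R k X : dual X -> {ptws X -> K^o}) f).
    exact: cvg_app.
  by have /pointwise_cvgP := h; apply.
have h : (@dual_fun R k X : dual X -> {ptws X -> K^o}) @ F --> (dual_fun f : {ptws X -> K^o}).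
  by apply/pointwise_cvgP.
move=> A [B [[C oC <-] /= Cf CA]]; apply: filterS CA _.
by apply: h; exact: open_nbhs_nbhs.
Qed.

Lemma weak_star_closureP A f : weak_star_closure A f <->
  exists F : set_system (dual X), [/\ ProperFilter F, F A &
    forall x, (fun g : dual X => g x : K^o) @ F --> (f x : K^o)].
Proof.
rewrite /weak_star_closure closureEcvg; split=> [[F FF [Ff FA]]|[F [FF FA Ff]]].
  exists F; split=> //; first by apply: FA.
  by apply/weak_star_cvgP.
exists F => //; split; first exact/weak_star_cvgP.
by move=> B AB; exact: filterS FA.
Qed.

Lemma weak_star_closure_affine A (c : K) g f : weak_star_closure A f ->
  weak_star_closure [set c *: h + g | h in A] (c *: f + g).
Proof.
move=> /weak_star_closureP[F [FF FA Ff]]; apply/weak_star_closureP.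
exists ((fun h => c *: h + g) @ F); split=> [|/=|x].
- exact: fmap_proper_filter.
- by apply: filterS FA => h Ah; exists h.
- have : (fun h : dual X => c * h x + g x : K^o) @ F --> (c * f x + g x : K^o).
    by apply: cvgD; [apply: cvgMl_tmp; exact: Ff|exact: cvg_cst].
  exact: cvg_trans.
Qed.

Lemma weak_star_closure_ge A f x (r : R) : (forall g, A g -> r <= scalar_re (g x)) ->
  weak_star_closure A f -> r <= scalar_re (f x).
Proof.
move=> Ar /weak_star_closureP[F [FF FA Ff]].
have h : (fun g : dual X => scalar_re (g x) : R^o) @ F --> (scalar_re (f x) : R^o).
  move=> B /(@scalar_re_continuous R k (f x)) nB; exact: (Ff x _ nB).
by apply: (cvgr_to_ge h); apply: filterS FA => g /Ar.
Qed.

Lemma subset_weak_star_closure A : A `<=` weak_star_closure A.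
Proof. exact: (@subset_closure (weak_star X)). Qed.

Lemma weak_star_closureS A B : A `<=` B -> weak_star_closure A `<=` weak_star_closure B.
Proof. exact: (@closureS (weak_star X)). Qed.

Lemma weak_star_closure_id A : weak_star_closure (weak_star_closure A) = weak_star_closure A.
Proof. by rewrite /weak_star_closure -(closure_id _).1//; exact: closed_closure. Qed.

Lemma norm_closure_weak_star A : closure A `<=` weak_star_closure A.
Proof.
move=> f clf; apply/weak_star_closureP.
exists (within A (nbhs f)); split=> [||x].
- exact: within_nbhs_proper.
- exact: withinT.
- apply: cvg_trans (cvg_app _ (@cvg_within _ (nbhs f) _ A)) _.
  apply: ((@cvgrPdist_lt K K^o _ (nbhs f) _ (fun g => g x) (f x)).2) => e e0.
  (* Adding 1 keeps the divisor positive when [x] is 0. *)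
  have c0 : 0 < `|x| + 1 by rewrite ltr_wpDl.
  have : \forall g \near f, ball f (e / (`|x| + 1)) g by apply: nbhsx_ballx; rewrite divr_gt0.
  apply: filterS => g; rewrite -ball_normE /= => fg.
  rewrite -[ltLHS]/(`|(f - g) x|); apply: le_lt_trans (dual_norm_le _ _) _.
  rewrite -dual_normE; apply: le_lt_trans (_ : `|f - g| * (`|x| + 1) < _).
    by rewrite ler_wpM2l// lerDl.
  by rewrite -ltr_pdivlMr.
Qed.

(* Banach-Alaoglu: a bounded ultrafilter converges at each point of [X], and the
   pointwise limit is linear and bounded. *)
Lemma compact_dual_ball (M : K) : compact ([set f : dual X | `|f| <= M] : set (weak_star X)).
Proof.
rewrite compact_ultra => F FU FM.
have FF : ProperFilter F by exact: ultra_proper.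
have [g0 g0M] := filter_ex FM.
have M0 : 0 <= M by apply: le_trans g0M.
(* Evaluation at [x] maps [F] to an ultrafilter on the compact ball of radius [M] times the norm of
   [x], so it converges there. *)
have /choice[l lP] : forall x, exists z : K^o, `|z| <= M * `|x| /\
    (fun g : dual X => g x : K^o) @ F --> z.
  move=> x; have FMx : F [set g : dual X | `|g x| <= M * `|x|].
    by apply: filterS FM => g gM; apply: le_trans (dual_norm_le g x) _; rewrite ler_wpM2r.
  have := @compact_scalar_ball R k (M * `|x|) (ger0_real (mulr_ge0 M0 (normr_ge0 x))).
  rewrite compact_ultra => /(_ ((fun g : dual X => g x : K^o) @ F)) cx.
  by have [z [zM Fz]] := cx (ultra_fmap _ FU) FMx; exists z.
have ll : linear (l : X -> K^o).
  move=> a x y; have h1 := (lP (a *: x + y)).2.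
  have h2 : (fun g : dual X => a * g x + g y : K^o) @ F --> (a * l x + l y : K^o).
    by apply: (cvgD _ (lP y).2); apply: cvgMl_tmp; exact: (lP x).2.
  have h3 : (fun g : dual X => g (a *: x + y) : K^o) @ F --> (a * l x + l y : K^o).
    by under eq_fun do rewrite (dual_linear _ a x y).
  exact: (cvg_unique (@norm_hausdorff K K^o) h1 h3).
have lc : continuous (l : X -> K^o).
  move=> x; apply: ((@cvgrPdist_lt K K^o _ (nbhs x) _ l (l x)).2) => e e0.
  have M1 : 0 < M + 1 by rewrite ltr_wpDl.
  have : \forall y \near x, ball x (e / (M + 1)) y by apply: nbhsx_ballx; rewrite divr_gt0.
  apply: filterS => y; rewrite -ball_normE /= => xy.
  have -> : l x - l y = l (x - y).
    by have := ll (-1) y x; rewrite !scaleN1r !(addrC (- _)).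
  apply: le_lt_trans (lP _).1 _; apply: le_lt_trans (_ : (M + 1) * `|x - y| < _).
    by rewrite ler_wpM2r// lerDl.
  by rewrite mulrC -ltr_pdivlMr.
have lD : (l : X -> K^o) \in @continuous_functional R k X by apply/asboolP.
exists (Dual lD); split.
  apply: dual_norm_lub => [|x x1]; first exact: ger0_real.
  by apply: le_trans (lP x).1 _; rewrite ler_piMr.
by apply/weak_star_cvgP => x; exact: (lP x).2.
Qed.

Lemma weak_star_closure_le A f x (r : R) : (forall g, A g -> scalar_re (g x) <= r) ->
  weak_star_closure A f -> scalar_re (f x) <= r.
Proof.
move=> Ar clf; rewrite -lerN2 -scalar_reN -raddfN.
apply: weak_star_closure_ge clf => g /Ar; by rewrite raddfN scalar_reN lerN2.
Qed.

End WeakStarTopology.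

(** * The Krein-Smulian theorem *)

Section PolarSteps.
Context {R : realType} {k : scalar_kind} {X : normedModType (scalars R k)}.
Local Notation K := (scalars R k).
Implicit Types (A : set (dual X)) (G s : seq X).

(** Equivalent to weak* closedness of the trace of [A] on every closed ball, such balls being weak*
    closed. *)
Definition boundedly_weak_star_closed A :=
  forall M : K, weak_star_closure (A `&` [set f | `|f| <= M]) `<=` A.

Definition real_polar G : set (dual X) :=
  [set f | forall x, x \in G -> scalar_re (f x) <= 1].

Lemma real_polar_cat G s : real_polar (G ++ s) = real_polar G `&` real_polar s.
Proof.
apply/seteqP; split=> [f fGs|f [fG fs] x]; last first.
  by rewrite mem_cat => /orP[/fG|/fs].
by split=> x xG; apply: fGs; rewrite mem_cat xG ?orbT.
Qed.

Lemma real_polar_closed G : weak_star_closure (real_polar G) `<=` real_polar G.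
Proof.
by move=> f clf x xG; apply: weak_star_closure_le clf => g /(_ x xG).
Qed.

(** A rotation of [x] turns [f x] into its modulus, so bounding real parts on the ball of radius
    [c^-1] bounds the norm. *)
Lemma dual_norm_le_polar (f : dual X) (c : K) : 0 < c ->
  (forall x, `|x| <= c^-1 -> scalar_re (f x) <= 1) -> `|f| <= c.
Proof.
move=> c0 fc; apply: dual_norm_lub => [|x x1]; first exact: gtr0_real.
have [u u1 uE] := rotate_to_norm (f x).
have : scalar_re (f ((c^-1 * u) *: x)) <= 1.
  have ci : 0 < c^-1 by rewrite invr_gt0.
  by apply: fc; rewrite normrZ normrM u1 mulr1 (gtr0_norm ci) ler_piMr// ltW.
rewrite linearZ /= -[X in scalar_re X]/(c^-1 * u * f x) -mulrA uE.
rewrite -(@scalar_re1 R k) scalar_re_le ?real1//; last first.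
  by rewrite realM ?normr_real// realV gtr0_real.
by rewrite ler_pdivrMl// mulr1.
Qed.

(** By compactness: otherwise the sets [D s], for [s] finite in the ball of radius [c^-1], generate
    a filter in a weak* compact ball. A cluster point lies in [A], in the polar of [G] and in the
    polar of the ball of radius [c^-1], hence has norm at most [c], a contradiction. *)
Lemma polar_step A G (c c' : K) : 0 < c -> boundedly_weak_star_closed A ->
  A `&` [set f | `|f| <= c] `&` real_polar G = set0 ->
  exists s, (forall x, x \in s -> `|x| <= c^-1) /\
    A `&` [set f | `|f| <= c'] `&` real_polar (G ++ s) = set0.
Proof.
move=> c0 bA AG0; apply: contrapT => /forallNP ns.
pose small := [set s : seq X | forall x, x \in s -> `|x| <= c^-1].
pose D s := A `&` [set f | `|f| <= c'] `&` real_polar (G ++ s).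
have Dcat s t : D (s ++ t) `<=` D s `&` D t.
  by move=> f; rewrite /D !real_polar_cat => -[[Af fc] [fG [fs ft]]].
have FF : ProperFilter (filter_from small D).
  apply: filter_from_proper => [|s ss].
    apply: filter_from_filter; first by exists [::].
    move=> s t ss st; exists (s ++ t); last exact: Dcat.
    by move=> x; rewrite mem_cat => /orP[/ss|/st].
  by have /not_andP[//|/eqP/set0P] := ns s.
have Fc : filter_from small D [set f | `|f| <= c'].
  by exists [::] => // f [[]].
have [g [_ clg]] := @compact_dual_ball R k X c' _ FF Fc.
have gD s : small s -> weak_star_closure (D s) g.
  by move=> ss B nB; apply: clg => //; exists s.
have gP s : small s -> real_polar (G ++ s) g.
  by move=> ss; apply: real_polar_closed; apply: weak_star_closureS (gD s ss) => f [].
suff : (A `&` [set f | `|f| <= c] `&` real_polar G) g by rewrite AG0.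
split; last by have := gP [::]; rewrite cats0; apply.
split.
  by apply: (bA c'); apply: weak_star_closureS (gD [::] _) => // f [].
apply: dual_norm_le_polar => // x xc; apply: (gP [:: x]).
  by move=> y; rewrite inE => /eqP ->.
by rewrite mem_cat inE eqxx orbT.
Qed.

Lemma dual_norm_nat_bound (f : dual X) : exists n, `|f| <= n.+1%:R.
Proof.
exists (Num.truncn (scalar_re `|f|)).
rewrite -(scalar_norm_reK f) -scalar_of_real_nat ler_scalar_of_real; apply: ltW.
rewrite scalar_of_realK; exact: truncnS_gt.
Qed.

(** Iterating [polar_step] over the radii 1, 2, 3, ... gives finite sets whose accumulated polars
    avoid [A] within growing balls. Any [f] in [A] lies in one of these balls, hence outside the
    polar reached there. *)
Lemma polar_sequence A : boundedly_weak_star_closed A ->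
  A `&` [set f | `|f| <= 1] = set0 ->
  exists F : nat -> seq X, (forall n x, x \in F n -> `|x| <= n.+1%:R^-1) /\
    forall f, A f -> exists n x, x \in F n /\ 1 <= scalar_re (f x).
Proof.
move=> bA A0.
have /choice[S SP] : forall nG : nat * seq X, exists s,
    A `&` [set f | `|f| <= nG.1.+1%:R] `&` real_polar nG.2 = set0 ->
    (forall x, x \in s -> `|x| <= nG.1.+1%:R^-1) /\
    A `&` [set f | `|f| <= nG.1.+2%:R] `&` real_polar (nG.2 ++ s) = set0.
  move=> [n G] /=.
  have [h|h] := pselect (A `&` [set f | `|f| <= n.+1%:R] `&` real_polar G = set0);
    last by exists [::].
  by have [s sP] := polar_step n.+2%:R (ltr0Sn _ n) bA h; exists s.
(* [G n] collects the finite sets of the first [n] steps. *)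
pose fix G n := if n is m.+1 then G m ++ S (m, G m) else [::].
have GP n : A `&` [set f | `|f| <= n.+1%:R] `&` real_polar (G n) = set0.
  elim: n => [|n IH]; last exact: (SP (n, G n) IH).2.
  by apply/seteqP; split=> // f [Af _]; rewrite -A0.
exists (fun n => S (n, G n)); split=> [n x|f Af]; first exact: (SP (n, G n) (GP n)).1.
have [n fn] := dual_norm_nat_bound f.
have : ~ real_polar (G n) f by move=> fG; suff : set0 f by []; rewrite -(GP n).
move=> /existsNP[x /not_implyP[xG /negP]]; rewrite -ltNge => /ltW fx.
suff [m xm] : exists m, x \in S (m, G m) by exists m, x.
elim: n xG {fn} => //= n IH; rewrite mem_cat => /orP[/IH//|xS].
by exists n.
Qed.

End PolarSteps.

(** The pairs [(n, j)] are enumerated by their codes, with value 0 at indices that code no entry.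
    Only finitely many indices come from [F n] with [n < N], so the norms tend to 0. *)
Lemma enum_null_sequence (K : numFieldType) (X : normedModType K) (F : nat -> seq X) :
  (forall n x, x \in F n -> `|x| <= n.+1%:R^-1) ->
  exists x : nat -> X, [/\ forall m, `|x m| <= 1,
    forall N, exists M, forall m, (M <= m)%N -> `|x m| <= N.+1%:R^-1 &
    forall n y, y \in F n -> exists m, x m = y].
Proof.
move=> Fle.
pose x m := if pickle_inv m is Some (n, j) then nth 0 (F n) j else 0.
have xP m : x m = 0 \/ exists n j, [/\ m = pickle (n, j), (j < size (F n))%N & x m = nth 0 (F n) j].
  rewrite /x; have := @pickle_invK (nat * nat)%type m.
  case: (pickle_inv m) => [[n j] /= nj|]; last by left.
  have [jF|jF] := ltnP j (size (F n)); last by left; rewrite nth_default.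
  by right; exists n, j.
exists x; split=> [m|N|n y yF].
- have [->|[n [j [_ jF ->]]]] := xP m; first by rewrite normr0.
  by apply: le_trans (Fle n _ (mem_nth _ jF)) _; rewrite invf_le1 ?ltr0Sn// ler1n.
(* This index exceeds the codes of all entries of [F n] with [n < N]. *)
- exists (\max_(n < N) \max_(j < size (F n)) (pickle (val n, val j)).+1)%N => m Mm.
  have [->|[n [j [mE jF ->]]]] := xP m; first by rewrite normr0 invr_ge0.
  have [nN|Nn] := ltnP n N.
    have := leq_trans (leq_bigmax (Ordinal nN)) Mm; rewrite mE => h.
    by have := leq_trans (leq_bigmax (Ordinal jF)) h; rewrite /= ltnn.
  apply: le_trans (Fle n _ (mem_nth _ jF)) _.
  by rewrite lef_pV2 ?posrE ?ltr0Sn// ler_nat.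
- exists (pickle (n, index y (F n))).
  by rewrite /x pickleK_inv nth_index.
Qed.

Lemma scalar_archi (R : realType) (k : scalar_kind) (e : scalars R k) : 0 < e ->
  exists N, N.+1%:R^-1 < e.
Proof.
move=> e0; pose r := scalar_re e^-1.
have eE : scalar_of_real r = e^-1 by rewrite scalar_reK// realV gtr0_real.
exists (Num.truncn r); rewrite invf_plt ?posrE ?ltr0Sn//.
by rewrite -eE -scalar_of_real_nat ltr_scalar_of_real truncnS_gt.
Qed.

Section KreinSmulian.
Context {R : realType} {k : scalar_kind} {X : completeNormedModType (scalars R k)}.
Local Notation K := (scalars R k).
Implicit Types (A : set (dual X)).

Lemma scalar_of_real_sum I (r : seq I) (P : pred I) (F : I -> R) :
  scalar_of_real (\sum_(i <- r | P i) F i) = \sum_(i <- r | P i) scalar_of_real (F i) :> K.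
Proof. exact: (big_morph _ scalar_of_realD scalar_of_real0). Qed.

(** [z] is the sum of the series, which converges by completeness: the weights add up to at most 1,
    so each tail obeys any bound on the remaining [x m]. *)
Lemma l1_null_sum (l : nat -> R) (x : nat -> X) :
  (forall n, 0 <= l n) -> (forall N, \sum_(n < N) l n <= 1) ->
  (forall N, exists M, forall m, (M <= m)%N -> `|x m| <= N.+1%:R^-1) ->
  exists z : X, forall N (c : K), (forall m, (N <= m)%N -> `|x m| <= c) ->
    `|z - \sum_(n < N) scalar_of_real (l n) *: x n| <= c.
Proof.
move=> l0 l1 x0; pose S N := \sum_(0 <= n < N) scalar_of_real (l n) *: x n.
have SB N M (c : K) : (forall m, (N <= m)%N -> `|x m| <= c) -> (N <= M)%N ->
    `|S M - S N| <= c.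
  move=> xc NM; have c0 : 0 <= c by apply: le_trans (xc N (leqnn N)).
  rewrite /S (big_cat_nat (leq0n N) NM)/= addrAC subrr add0r.
  apply: le_trans (ler_norm_sum _ _ _) _.
  apply: le_trans (_ : \sum_(N <= n < M) scalar_of_real (l n) * c <= _).
    rewrite !big_nat; apply: ler_sum => n /andP[Nn _].
    rewrite normrZ normr_scalar_of_real (ger0_norm (l0 n)) ler_wpM2l ?xc//.
    by rewrite -scalar_of_real0 ler_scalar_of_real.
  rewrite -mulr_suml -scalar_of_real_sum ler_piMl//.
  rewrite -(@scalar_of_real1 R k) ler_scalar_of_real; apply: le_trans (l1 M).
  rewrite -(big_mkord xpredT l) (big_cat_nat (leq0n N) NM)/= lerDr.
  exact: sumr_ge0.
have cS : cvg (S @ \oo).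
  apply/cauchy_cvgP/cauchy_exP => e e0.
  have [N Ne] := scalar_archi e0; have [M Mx] := x0 N.
  exists (S M), M => // n /= Mn; rewrite -ball_normE /= distrC.
  exact: le_lt_trans (SB _ _ _ Mx Mn) Ne.
exists (lim (S @ \oo)) => N c xc.
rewrite -(big_mkord xpredT (fun n => scalar_of_real (l n) *: x n)).
have c0 : 0 <= c by apply: le_trans (xc N (leqnn N)).
have Scvg : (fun n => S n - S N) @ \oo --> lim (S @ \oo) - S N.
  by apply: cvgB; [exact: cS|exact: cvg_cst].
apply: (closed_cvg (fun y : X => `|y| <= c) _ _ _ Scvg).
  exact: closed_norm_le (ger0_real c0).
by exists N => // n /= Nn; exact: SB.
Qed.

(** Sending [f] to the real parts of [f (x m)] carries [A] to a convex set of sequences tending to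
    0, each at least 1 somewhere. The weights [l] from [l1_separation] pull back to the point [z],
    the sum of the vectors [x n] weighted by [l n]. *)
Lemma separate_from_ball A : convex_set A -> boundedly_weak_star_closed A ->
  A `&` [set f | `|f| <= 1] = set0 ->
  exists x : X, forall f, A f -> 1 <= scalar_re (f x).
Proof.
move=> cA bA A0; have [F [Fle FA]] := polar_sequence bA A0.
have [x [x1 xN xF]] := enum_null_sequence Fle.
pose C := [set (fun m => scalar_re (f (x m))) | f in A].
have fle (f : dual X) (z : X) (c : R) : `|z| <= scalar_of_real c ->
    `|scalar_re (f z)| <= scalar_re `|f| * c.
  move=> zc; apply: le_trans (norm_scalar_re_le _) _.
  rewrite -(@ler_scalar_of_real R k) scalar_norm_reK scalar_of_realM scalar_norm_reK.
  by apply: le_trans (dual_norm_le f z) _; rewrite ler_wpM2l// dual_norm_ge0.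
have [| | |l [l0 l1 lC]] := @l1_separation R C.
- apply/convex_setP => _ _ t [f Af <-] [g Ag <-] t0 t1.
  exists (scalar_of_real t *: f + (1 - scalar_of_real t) *: g).
    apply: (convex_setP A).1 => //.
      by rewrite -scalar_of_real0 ler_scalar_of_real.
    by rewrite -scalar_of_real1 ler_scalar_of_real.
  apply/funext => m.
  rewrite -[RHS]/(t * scalar_re (f (x m)) + (1 - t) * scalar_re (g (x m))).
  have -> : 1 - scalar_of_real t = scalar_of_real (1 - t) :> K.
    by apply/eqP; rewrite subr_eq -scalar_of_realD subrK scalar_of_real1.
  by rewrite -!scalar_reMl -scalar_reD.
- move=> _ [f Af <-]; exists (scalar_re `|f| * 1) => n.
  by apply: fle; rewrite scalar_of_real1.
- move=> _ [f /FA[n [y [yF fy]]] <-].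
  by have [m xm] := xF n y yF; exists m; rewrite xm.
have [z zP] := l1_null_sum l0 l1 xN.
exists z => f Af; set r := scalar_re `|f|.
have r0 : 0 <= r by rewrite -(@ler_scalar_of_real R k) scalar_of_real0 scalar_norm_reK.
(* One error term comes from the tail in [l1_separation], the other from the tail of the series for
   [z]. *)
have key N : 1 - r * N.+1%:R^-1 *+ 2 <= scalar_re (f z).
  have [M xM] := xN N.
  have Nre : scalar_of_real N.+1%:R^-1 = N.+1%:R^-1 :> K.
    have n0 : N.+1%:R != 0 :> K by rewrite pnatr_eq0.
    apply: (mulfI n0); rewrite divff// -scalar_of_real_nat -scalar_of_realM.
    by rewrite divff ?pnatr_eq0// scalar_of_real1.
  have xr n : (M <= n)%N -> `|scalar_re (f (x n))| <= r * N.+1%:R^-1.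
    by move=> Mn; apply: fle; rewrite Nre xM.
  have c0 : 0 <= r * N.+1%:R^-1 by rewrite mulr_ge0// invr_ge0.
  have h1 : 1 - r * N.+1%:R^-1 <= \sum_(n < M) l n * scalar_re (f (x n)).
    exact: lC _ M _ (ex_intro2 _ _ f Af erefl) c0 xr.
  have := zP M _ xM; rewrite -Nre => /(fle f).
  rewrite raddfB /= scalar_reD scalar_reN raddf_sum /=.
  have -> : scalar_re (\sum_(n < M) f (scalar_of_real (l n) *: x n)) =
      \sum_(n < M) l n * scalar_re (f (x n)).
    have re0 : scalar_re (0 : K) = 0 by rewrite -scalar_of_real0 scalar_of_realK.
    rewrite (big_morph _ (@scalar_reD R k) re0); apply: eq_bigr => n _.
    by rewrite linearZ -scalar_reMl.
  rewrite -/r ler_norml => /andP[h2 _]; move: h1 h2.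
  move: (r / _) (\sum_(_ < _) _) => q s; lra.
rewrite leNgt; apply/negP => fz1.
(* Small enough that, once [m^-1 < d], the two errors in [key] do not fill the gap
   [1 - scalar_re (f z)]. The added 1 keeps the divisor positive. *)
pose d := (1 - scalar_re (f z)) / (r *+ 2 + 1).
have d0 : 0 < d by rewrite divr_gt0 ?subr_gt0// ltr_wpDl// mulrn_wge0.
have := key (Num.truncn d^-1); set m := (_.+1%:R : R).
have mi : m^-1 < d by rewrite invf_plt ?posrE ?ltr0Sn//; exact: truncnS_gt.
have : (r *+ 2 + 1) * m^-1 < 1 - scalar_re (f z).
  by rewrite mulrC -ltr_pdivlMr// ltr_wpDl// mulrn_wge0.
have : 0 < m^-1 by rewrite invr_gt0 ltr0Sn.
rewrite mulrDl mul1r mulrnAl; set q := r * m^-1; set s := m^-1; lra.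
Qed.

(** [A] is norm closed, so a point [f] outside has a ball around it missing [A]. After moving this
    ball to the unit ball, [separate_from_ball] gives an [x] at which the moved set has real parts
    at least 1, although 0 is in its weak* closure. *)
Theorem krein_smulian A : convex_set A -> boundedly_weak_star_closed A ->
  weak_star_closure A `<=` A.
Proof.
move=> cA bA f clf; apply: contrapT => nAf.
have [e e0 eA] : exists2 e : K, 0 < e & A `&` [set g | `|g - f| <= e] = set0.
  apply: contrapT => ne; apply: nAf; apply: (bA (`|f| + 1)).
  apply: norm_closure_weak_star => B /nbhs_ballP[e /= e0 eB].
  (* The bound [e / 2] puts [g] in the neighbourhood of [f], the bound 1 puts it in the bounded part
     of [A]. *)
  pose d := Num.min (e / 2) 1.
  have er : e / 2 \is Num.real by rewrite gtr0_real// divr_gt0.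
  have d0 : 0 < d by rewrite comparable_lt_min ?real_comparable// divr_gt0 ?ltr01.
  apply: contrapT => nAB; apply: ne; exists d => //.
  apply/seteqP; split=> // g [Ag /= gd]; apply: nAB; exists g.
  have gd1 : `|g - f| <= e / 2 /\ `|g - f| <= 1.
    by move: gd; rewrite comparable_le_min ?real_comparable// => /andP[].
  split; first split=> //=.
    by rewrite -{1}(subrK f g) addrC; apply: le_trans (ler_normD _ _) _; rewrite lerD2l gd1.2.
  apply: eB; rewrite -ball_normE /= distrC; apply: le_lt_trans gd1.1 _.
  by rewrite ltr_pdivrMr// ltr_pMr// ltr1n.
pose A' := [set g | A (e *: g + f)].
have cA' : convex_set A'.
  apply/convex_setP => g h t Ag Ah t0 t1; rewrite /A' /=.
  have := (convex_setP A).1 cA _ _ t Ag Ah t0 t1; congr A.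
  rewrite !scalerDr !scalerA !(mulrC e) addrACA; congr (_ + _).
  by rewrite -scalerDl addrC subrK scale1r.
have bA' : boundedly_weak_star_closed A'.
  move=> M g clg; change (A (e *: g + f)); apply: (bA (e * M + `|f|)).
  have := @weak_star_closure_affine _ _ _ _ e f _ clg; apply: weak_star_closureS.
  move=> _ [h [Ah hM] <-]; split=> //=; apply: le_trans (ler_normD _ _) _.
  by rewrite lerD2r normrZ gtr0_norm// ler_wpM2l// ltW.
have A'0 : A' `&` [set f | `|f| <= 1] = set0.
  apply/seteqP; split=> // g [Ag /= g1].
  suff : (A `&` [set h | `|h - f| <= e]) (e *: g + f) by rewrite eA.
  by split=> //=; rewrite addrK normrZ gtr0_norm// ler_piMr// ltW.
have [x xA'] := separate_from_ball cA' bA' A'0.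
have := @weak_star_closure_affine _ _ _ _ e^-1 (- (e^-1 *: f)) _ clf; rewrite subrr.
move=> /(weak_star_closure_ge (x := x) (r := 1)) h.
have : 1 <= scalar_re ((0 : dual X) x).
  apply: h => _ [g Ag <-]; apply: xA'; rewrite /A' /=.
  by rewrite scalerDr scalerN !scalerA divff ?gt_eqF// !scale1r subrK.
have -> : scalar_re ((0 : dual X) x) = 0.
  by rewrite -[X in scalar_re X]/(0 : K) -scalar_of_real0 scalar_of_realK.
by rewrite ler10.
Qed.

End KreinSmulian.

(** * Convex sets with interior points *)

Section ConvexInterior.
Context {K : numFieldType} {V : normedModType K}.
Implicit Types (A C : set V) (u f z : V) (s rho : K).

(** For [y] in [A] close to [z], a point [f] of the small ball is a convex combination of [y] and a
    point [v] of the ball around [u]. *)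
Lemma convex_ball_closure A u rho z s : convex_set A -> ball u rho `<=` A ->
  closure A z -> 0 < s -> s <= 1 -> ball ((1 - s) *: z + s *: u) (s * rho) `<=` A.
Proof.
move=> cA uA clz s0 s1 f; rewrite -ball_normE /=.
set d := _ - f => fd.
(* With [y] within this slack of [z], the point [v] stays in the ball around [u]. *)
have e0 : 0 < s * rho - `|d| by rewrite subr_gt0.
have [y [Ay]] := clz _ (nbhsx_ballx z _ e0); rewrite -ball_normE /= => zy.
have s1' : `|1 - s| <= 1 by rewrite ger0_norm ?subr_ge0// gerBl ltW.
(* [v] solves [f = s *: v + (1 - s) *: y]. *)
pose v := s^-1 *: ((1 - s) *: (z - y) - d) + u.
have -> : f = s *: v + (1 - s) *: y.
  rewrite scalerDr scalerA divff ?gt_eqF// scale1r scalerBr /d opprB.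
  by rewrite [RHS]addrAC [X in _ = X + _]addrAC subrK [RHS]addrAC [RHS]addrC subrK.
apply: (convex_setP A).1 => //; last exact: ltW.
apply: uA; rewrite -ball_normE /= /v opprD addrCA subrr addr0 normrN.
rewrite normrZ normfV (gtr0_norm s0) ltr_pdivrMl//.
apply: le_lt_trans (ler_normB _ _) _; rewrite -ltrBrDr; apply: le_lt_trans zy.
by rewrite normrZ ler_piMl.
Qed.

Lemma convex_ball A u rho z s : convex_set A -> ball u rho `<=` A ->
  A z -> 0 < s -> s <= 1 -> ball ((1 - s) *: z + s *: u) (s * rho) `<=` A.
Proof. by move=> cA uA Az; apply: convex_ball_closure => //; exact: subset_closure. Qed.

(** The segment from [u] to [f] can be prolonged slightly to a point [z] still in [C]. *)
Lemma interior_extend C f u : interior C f ->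
  exists s z, [/\ 0 < s, s <= 1, C z & f = (1 - s) *: z + s *: u].
Proof.
move=> /nbhs_ballP[e /= e0 eC].
have n0 : 0 < `|f - u| + 1 by rewrite ltr_wpDl.
pose t := e / (`|f - u| + 1).
have t0 : 0 < t by rewrite divr_gt0.
have t1 : 0 < 1 + t by rewrite addr_gt0.
exists (t / (1 + t)), (f + t *: (f - u)); split.
- by rewrite divr_gt0.
- by rewrite ler_pdivrMr// mul1r lerDr.
- apply: eC; rewrite -ball_normE /= opprD addrA subrr add0r normrN normrZ gtr0_norm//.
  by rewrite mulrAC ltr_pdivrMr// ltr_pM2l// ltrDl.
have -> : 1 - t / (1 + t) = (1 + t)^-1.
  by field; rewrite gt_eqF.
rewrite (mulrC t) -[((1 + t)^-1 * t) *: u]scalerA -scalerDr -addrA -scalerDr subrK.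
by rewrite -{2}(scale1r f) -scalerDl scalerA mulVf ?scale1r// gt_eqF.
Qed.

Lemma interior_nonempty_ball A u : interior A u -> exists2 rho, 0 < rho & ball u rho `<=` A.
Proof. by move=> /nbhs_ballP[rho rho0 ?]; exists rho. Qed.

(** A point interior to the closure lies between [u] and a point of the closure, so
    [convex_ball_closure] puts a ball inside [A] around it. *)
Lemma convex_interior_closure A : convex_set A -> interior A !=set0 ->
  interior (closure A) = interior A.
Proof.
move=> cA [u /interior_nonempty_ball[rho rho0 uA]]; apply/seteqP; split; last first.
  exact/interiorS/subset_closure.
move=> f /(interior_extend u)[s [z [s0 s1 clz ->]]].
apply/nbhs_ballP; exists (s * rho) => /=; first exact: mulr_gt0.
exact: convex_ball_closure.
Qed.

Lemma limit_toward C f u : (forall s, 0 < s -> s <= 1 -> C ((1 - s) *: f + s *: u)) ->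
  closure C f.
Proof.
move=> Cs B /nbhs_ballP[e /= e0 eB].
have n0 : 0 < `|f - u| + 1 + e by rewrite addr_gt0// ltr_wpDl.
pose s := e / (`|f - u| + 1 + e).
have s0 : 0 < s by rewrite divr_gt0.
have s1 : s <= 1 by rewrite ler_pdivrMr// mul1r lerDr addr_ge0.
exists ((1 - s) *: f + s *: u); split; first exact: Cs.
apply: eB; rewrite -ball_normE /=.
have -> : f - ((1 - s) *: f + s *: u) = s *: (f - u).
  by rewrite scalerBl scale1r scalerBr opprD opprB addrA addrCA subrr addr0.
rewrite normrZ gtr0_norm// mulrAC ltr_pdivrMr// ltr_pM2l//.
by rewrite -addrA ltrDl addr_gt0.
Qed.

Lemma convex_closure_interior A : convex_set A -> interior A !=set0 ->
  A `<=` closure (interior A).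
Proof.
move=> cA [u /interior_nonempty_ball[rho rho0 uA]] z Az; apply: (limit_toward (u := u)) => s s0 s1.
apply/nbhs_ballP; exists (s * rho) => /=; first exact: mulr_gt0.
exact: convex_ball.
Qed.

Lemma closure_affine A s u f : closure A f -> closure [set s *: g + u | g in A] (s *: f + u).
Proof.
move=> clf B nB.
have c : continuous (fun g => s *: g + u).
  by move=> g; apply: cvgD; [exact: scaler_continuous|exact: cvg_cst].
have [g [Ag Bg]] := clf _ (c f B nB).
by exists (s *: g + u); split=> //; exists g.
Qed.

End ConvexInterior.

(* Convexity passes to a closure operator that commutes with affine maps: fix one
   point in the set first, then the other in the closure. *)
Lemma convex_closure_operator (K : numFieldType) (V : lmodType K)
    (cl : set V -> set V) (A : set V) :
  (forall B C, B `<=` C -> cl B `<=` cl C) -> (forall B, cl (cl B) `<=` cl B) ->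
  (forall B (s : K) u f, cl B f -> cl [set s *: g + u | g in B] (s *: f + u)) ->
  convex_set A -> convex_set (cl A).
Proof.
move=> clS clK clZ /convex_setP cA; apply/convex_setP => f g t Af Ag t0 t1.
have h y : A y -> cl A (t *: f + (1 - t) *: y).
  move=> Ay; apply: clS (clZ _ t ((1 - t) *: y) _ Af).
  by move=> _ [x Ax <-]; exact: cA.
apply: clK; rewrite addrC; apply: clS (clZ _ (1 - t) (t *: f) _ Ag).
by move=> _ [y Ay <-]; rewrite addrC; exact: h.
Qed.

Lemma convex_closure (K : numFieldType) (V : normedModType K) (A : set V) :
  convex_set A -> convex_set (closure A).
Proof.
apply: convex_closure_operator; first exact: closureS.
  by move=> B; rewrite -(closure_id _).1//; exact: closed_closure.
by move=> B s u f; exact: closure_affine.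
Qed.

Lemma bounded_setP (K : numFieldType) (V : normedModType K) (A : set V) :
  bounded_set A <-> exists M, A `<=` [set x | `|x| <= M].
Proof.
split=> [/pinfty_ex_gt0[M _ AM]|[M AM]]; first by exists M.
(* For a nonempty set [M] dominates a norm, hence is real; the empty set takes the bound 0. *)
have [->|/set0P[x Ax]] := eqVneq A set0; first by exists 0; split=> // N _ y.
exists M; split=> [|N MN y Ay]; first exact/ger0_real/(le_trans _ (AM x Ax)).
exact: le_trans (AM y Ay) (ltW MN).
Qed.

(** * Envelopes *)

Section Envelope.
Context {R : realType} {k : scalar_kind} {X : normedModType (scalars R k)}.
Local Notation K := (scalars R k).
Implicit Types (A B U V : set (dual X)) (f g u : dual X).

Lemma convex_weak_star_closure A : convex_set A -> convex_set (weak_star_closure A).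
Proof.
apply: convex_closure_operator => [B C|B|B s u f].
- exact: weak_star_closureS.
- by rewrite weak_star_closure_id.
- exact: weak_star_closure_affine.
Qed.

Lemma subset_weak_star_derived A : A `<=` weak_star_derived A.
Proof.
move=> f Af; have [n fn] := dual_norm_nat_bound f.
(* [ball] is defined by a strict inequality, hence one more than the bound [n.+1]. *)
exists n.+2 => //; apply: subset_weak_star_closure; split=> //.
rewrite -ball_normE /= sub0r normrN; apply: le_lt_trans fn _.
by rewrite ltr_nat.
Qed.

Lemma weak_star_derivedS A B : A `<=` B -> weak_star_derived A `<=` weak_star_derived B.
Proof.
move=> AB f [n _ fn]; exists n => //.
by apply: weak_star_closureS fn => g [/AB].
Qed.

Lemma weak_star_derived_sub A : weak_star_derived A `<=` weak_star_closure A.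
Proof. by move=> f [n _]; apply: weak_star_closureS => g []. Qed.

Lemma convex_ball_set (V : normedModType K) (c : V) (r : K) : convex_set (ball c r).
Proof.
apply/convex_setP => x y t; rewrite -ball_normE /= => cx cy t0 t1.
have -> : c - (t *: x + (1 - t) *: y) = t *: (c - x) + (1 - t) *: (c - y).
  rewrite !scalerBr addrACA -scalerDl addrC (addrC t) subrK scale1r.
  by rewrite -opprD addrC.
apply: le_lt_trans (ler_normD _ _) _; rewrite !normrZ !ger0_norm ?subr_ge0//.
(* The strict inequality comes from the term weighted by [t], so [t = 0] is treated apart. *)
have [->|t0'] := eqVneq t 0; first by rewrite mul0r subr0 mul1r add0r.
have -> : r = t * r + (1 - t) * r by rewrite -mulrDl addrC subrK mul1r.
apply: ltr_leD; first by rewrite ltr_pM2l// lt_def t0'.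
by rewrite ler_wpM2l ?subr_ge0// ltW.
Qed.

(** Both points are weak* limits of the bounded part with the larger index, which is convex and so
    has a convex weak* closure. *)
Lemma convex_weak_star_derived A : convex_set A -> convex_set (weak_star_derived A).
Proof.
move=> /convex_setP cA; apply/convex_setP => f g t [n _ fn] [m _ gm] t0 t1.
exists (maxn n m) => //.
have le_ball (i : nat) : (i <= maxn n m)%N ->
    A `&` ball 0 i%:R `<=` A `&` ball 0 (maxn n m)%:R.
  move=> im h [Ah]; rewrite -ball_normE /= => hi; split=> //=.
  by apply: lt_le_trans hi _; rewrite ler_nat.
have cI : convex_set (A `&` ball (0 : dual X) (maxn n m)%:R).
  apply/convex_setP => x y s [Ax xb] [Ay yb] s0 s1; split; first exact: cA.
  by apply: (convex_setP _).1 => //; exact: convex_ball_set.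
apply: (convex_setP _).1 => //; first exact: convex_weak_star_closure.
  by apply: weak_star_closureS fn; exact/le_ball/leq_maxl.
by apply: weak_star_closureS gm; exact/le_ball/leq_maxr.
Qed.

(** A translation by less than half the distance [d] keeps [B] bounded within [U] and moves its
    weak* closure along. *)
Lemma envelope_open U : open (envelope U).
Proof.
rewrite openE => f [B [BU bB [d d0 Bd]] clf].
have dr : d / 2 \is Num.real by rewrite gtr0_real// divr_gt0.
apply/nbhs_ballP; exists (d / 2) => /=; first exact: divr_gt0.
move=> h; rewrite -ball_normE /= distrC; set g := h - f => gd.
exists [set 1 *: b + g | b in B]; last first.
  rewrite (_ : h = 1 *: f + g); first exact: weak_star_closure_affine.
  by rewrite scale1r addrC subrK.
have far b h' : B b -> ~ U h' -> d / 2 <= `|1 *: b + g - h'|.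
  move=> Bb Uh'; rewrite -(lerD2r (d / 2)) -splitr; apply: le_trans (Bd _ _ Bb Uh') _.
  rewrite scale1r (_ : b - h' = b + g - h' - g); last by rewrite addrAC addrK.
  by apply: le_trans (ler_normB _ _) _; rewrite lerD2l ltW.
split; last by exists (d / 2) => [|_ h' [b Bb <-]]; [exact: divr_gt0|exact: far].
  move=> _ [b Bb <-]; apply: contrapT => /(far _ _ Bb).
  have d20 : 0 < d / 2 by rewrite divr_gt0.
  by rewrite subrr normr0 => /(lt_le_trans d20); rewrite ltxx.
move/bounded_setP: bB => [M BM]; apply/bounded_setP; exists (M + d / 2).
move=> _ [b /BM bM <-] /=; rewrite scale1r; apply: le_trans (ler_normD _ _) _.
by rewrite lerD// ltW.
Qed.

(** Singletons are bounded within an open set. *)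
Lemma subset_envelope U : open U -> U `<=` envelope U.
Proof.
rewrite openE => oU f /oU /nbhs_ballP[e /= e0 eU].
exists [set f]; last exact: subset_weak_star_closure.
split=> [_ -> ||]; first by apply: eU; exact: ballxx.
  by apply/bounded_setP; exists `|f| => _ -> /=.
exists e => // _ g -> Ug; rewrite real_leNgt ?(gtr0_real e0) ?normr_real//.
by apply/negP => fg; apply: Ug; apply: eU; rewrite -ball_normE.
Qed.

Lemma bounded_sub_ball A M : A `<=` [set f | `|f| <= M] ->
  exists n, A `<=` ball 0 n%:R.
Proof.
move=> AM; have [->|/set0P[f /AM /= fM]] := eqVneq A set0; first by exists 0%N.
have Mr : M \is Num.real by apply/ger0_real/(le_trans _ fM).
exists (Num.truncn (scalar_re M)).+1 => g /AM /= gM.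
rewrite -ball_normE /= sub0r normrN; apply: le_lt_trans gM _.
by rewrite -(scalar_reK Mr) -scalar_of_real_nat ltr_scalar_of_real scalar_of_realK truncnS_gt.
Qed.

Lemma envelope_sub_derived U : envelope U `<=` weak_star_derived U.
Proof.
move=> f [B [BU /bounded_setP[M BM] _] clf].
have [n Bn] := bounded_sub_ball BM; exists n => //.
by apply: weak_star_closureS clf => b Bb; split; [exact: BU|exact: Bn].
Qed.

(* Contracting a bounded subset of the closure of [A] towards an interior point [u]
   of [A] makes it bounded within the interior of [A]. *)
Lemma envelope_contract A B u f (M s : K) : convex_set A -> interior A u ->
  B `<=` closure A -> B `<=` [set g | `|g| <= M] -> weak_star_closure B f ->
  0 < s -> s <= 1 -> envelope (interior A) ((1 - s) *: f + s *: u).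
Proof.
move=> cA /interior_nonempty_ball[rho rho0 uA] BA BM clf s0 s1.
have srho : 0 < s * rho by rewrite mulr_gt0.
have bA b : B b -> ball ((1 - s) *: b + s *: u) (s * rho) `<=` interior A.
  move=> /BA Ab; rewrite -open_subsetE; last exact: ball_open.
  exact: convex_ball_closure.
exists [set (1 - s) *: b + s *: u | b in B]; last exact: weak_star_closure_affine.
split=> [_ [b /bA bs <-]||].
- by apply: bs; exact: ballxx.
- apply/bounded_setP; exists (`|1 - s| * M + `|s *: u|) => _ [b /BM bM <-] /=.
  by apply: le_trans (ler_normD _ _) _; rewrite lerD2r normrZ ler_wpM2l.
- exists (s * rho) => // _ g [b Bb <-] Ag.
  rewrite real_leNgt ?(gtr0_real srho) ?normr_real//; apply/negP => bg; apply: Ag.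
  by apply: (bA b Bb); rewrite -ball_normE.
Qed.

(** Stated for convex sets with interior points, not only for open ones, so that it applies to the
    iterated derived sets. *)
Lemma interior_weak_star_derived A : convex_set A -> interior A !=set0 ->
  interior (weak_star_derived A) = envelope (interior A).
Proof.
move=> cA [u Au]; apply/seteqP; split=> [f|]; last first.
  rewrite -open_subsetE; last exact: envelope_open.
  apply: subset_trans (@envelope_sub_derived (interior A)) _.
  by apply: weak_star_derivedS; exact: interior_subset.
move=> /(interior_extend u)[s [g [s0 s1 [n _ clg] ->]]].
apply: (envelope_contract (M := n%:R) cA Au _ _ clg) => // h [Ah].
  by move=> _; exact: subset_closure.
by rewrite -ball_normE /= sub0r normrN => /ltW.
Qed.

End Envelope.

(** * Iteration along ordinals *)

Section Transfinite.
Context {R : realType} {k : scalar_kind} {X : normedModType (scalars R k)}.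
Variable U : set (dual X).
Hypotheses (U_open : open U) (U_convex : convex_set U).
Context {d : Order.disp_t} {W : orderType d}.
Variable wf : well_founded (fun v w : W => (v < w)%O).
Local Notation derived := (transfinite wf weak_star_derived U).
Local Notation enveloped := (transfinite wf envelope U).

(** Monotonicity goes through the same induction as convexity: at a limit it brings two points to a
    common stage. *)
Lemma transfinite_derived_prop w :
  [/\ convex_set (derived w), U `<=` derived w &
      forall v, (v < w)%O -> derived v `<=` derived w].
Proof.
elim/(well_founded_ind wf): w => w IH.
have [w0|[v vw]|wl] := ordinal_cases w.
- by rewrite (transfinite_zero _ _ _ w0); split=> // v /w0.
- have [cv Uv sv] := IH v vw.1; rewrite (transfinite_succ _ _ _ vw); split.
  + exact: convex_weak_star_derived.
  + exact: subset_trans Uv (@subset_weak_star_derived _ _ _ _).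
  + move=> u /vw.2; rewrite le_eqVlt => /predU1P[->|uv].
      exact: subset_weak_star_derived.
    exact: subset_trans (sv u uv) (@subset_weak_star_derived _ _ _ _).
- have sub v : (v < w)%O -> derived v `<=` derived w.
    by move=> vw f fv; rewrite (transfinite_limit _ _ _ wl); exists v.
  split=> //; last first.
    have [v vw] : exists v, (v < w)%O by apply: contrapT => /forallNP; exact: wl.1.
    by have [_ Uv _] := IH v vw; exact: subset_trans Uv (sub v vw).
  apply/convex_setP => f g t; rewrite {1 2}(transfinite_limit _ _ _ wl).
  move=> [u /= uw fu] [v /= vw gv] t0 t1.
  have [m mw [fm gm]] : exists2 m, (m < w)%O & derived m f /\ derived m g.
    have [uv|vu|uv] := ltgtP u v.
    + by exists v => //; split=> //; have [_ _ /(_ u uv)] := IH v vw; apply.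
    + by exists u => //; split=> //; have [_ _ /(_ v vu)] := IH u uw; apply.
    + by exists v => //; split=> //; rewrite -uv.
  have [cm _ _] := IH m mw.
  by apply: (sub m mw); apply: (convex_setP _).1.
Qed.

(** At a limit, the segment from [u] to a point interior to the union is prolonged to some [z] in an
    earlier stage [v]. As [u] is interior to every stage, the point is already interior to stage
    [v]. *)
Lemma transfinite_envelope w : U !=set0 ->
  enveloped w = interior (derived w).
Proof.
move=> [u Uu]; elim/(well_founded_ind wf): w => w IH.
have intU v : interior (derived v) u.
  have [_ Uv _] := transfinite_derived_prop v.
  by apply: (interiorS Uv); rewrite (interior_id _).1.
have [w0|[v vw]|wl] := ordinal_cases w.
- by rewrite !(transfinite_zero _ _ _ w0) (interior_id _).1.
- rewrite !(transfinite_succ _ _ _ vw) (IH v vw.1) interior_weak_star_derived//.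
    by have [] := transfinite_derived_prop v.
  by exists u.
apply/seteqP; split=> f.
  rewrite (transfinite_limit _ _ _ wl) => -[v /= vw]; rewrite (IH v vw).
  by apply: interiorS; have [_ _] := transfinite_derived_prop w; apply.
move=> /(interior_extend u)[s [z [s0 s1 + ->]]].
rewrite !(transfinite_limit _ _ _ wl) => -[v /= vw zv]; exists v => //=.
rewrite (IH v vw); have [rho rho0 urho] := interior_nonempty_ball (intU v).
have [cv _ _] := transfinite_derived_prop v.
apply/nbhs_ballP; exists (s * rho) => /=; first exact: mulr_gt0.
exact: convex_ball.
Qed.

End Transfinite.

(** * The empty set *)

Section EmptySet.
Context {R : realType} {k : scalar_kind} {X : normedModType (scalars R k)}.

Lemma weak_star_closure0 : weak_star_closure (@set0 (dual X)) = set0.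
Proof. exact: (@closure0 (weak_star X)). Qed.

Lemma weak_star_derived0 : weak_star_derived (@set0 (dual X)) = set0.
Proof.
by apply/seteqP; split=> // f [n _]; rewrite set0I weak_star_closure0.
Qed.

Lemma envelope0 : envelope (@set0 (dual X)) = set0.
Proof.
by apply/seteqP; split=> // f /envelope_sub_derived; rewrite weak_star_derived0.
Qed.

Lemma transfinite0 (d : Order.disp_t) (W : orderType d)
    (wf : well_founded (fun v w : W => (v < w)%O)) (T : Type) (step : set T -> set T) w :
  step set0 = set0 -> transfinite wf step set0 w = set0.
Proof.
move=> step0; elim/(well_founded_ind wf): w => w IH.
have [w0|[v vw]|wl] := ordinal_cases w.
- by rewrite (transfinite_zero _ _ _ w0).
- by rewrite (transfinite_succ _ _ _ vw) (IH v vw.1).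
- rewrite (transfinite_limit _ _ _ wl).
  by apply/seteqP; split=> // f [v /= vw]; rewrite (IH v vw).
Qed.

End EmptySet.

(** A set bounded within the envelope lies in the weak* closure of some [B n], so its own weak*
    closure does too. *)
Lemma boundedly_regular_envelope (R : realType) (k : scalar_kind)
    (X : normedModType (scalars R k)) (U : set (dual X)) :
  boundedly_regular U -> envelope (envelope U) = envelope U.
Proof.
move=> [B [Bb _ _] [_ clBf _]]; apply/seteqP; split; last first.
  exact/subset_envelope/envelope_open.
move=> f [C Cb Cf]; have [n CB] := clBf _ Cb.
exists (B n) => //; rewrite -[weak_star_closure _]weak_star_closure_id.
exact: weak_star_closureS Cf.
Qed.

(** * Equivalent forms of the stability of the envelope *)

Section Equivalences.
Context {R : realType} {k : scalar_kind} {X : completeNormedModType (scalars R k)}.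
Variable U : set (dual X).
Hypotheses (U_open : open U) (U_convex : convex_set U) (U0 : U !=set0).
Local Notation D := (weak_star_derived U).

Let cD : convex_set D. Proof. exact: convex_weak_star_derived. Qed.

Lemma envelope_interior_derived : envelope U = interior D.
Proof. by rewrite interior_weak_star_derived// (interior_id _).1. Qed.

Let D0 : interior D !=set0.
Proof.
have [u Uu] := U0; exists u; apply: (interiorS (@subset_weak_star_derived _ _ _ U)).
by rewrite (interior_id _).1.
Qed.

(** As [D] and [closure D] have the same interior, it suffices that [weak_star_closure U] lies in
    [closure D]; Krein-Smulian gives this once [closure D] is boundedly weak* closed. *)
Lemma envelope_idem_interior : envelope (envelope U) = envelope U ->
  envelope U = interior (weak_star_closure U).
Proof.
move=> UU; rewrite [LHS]envelope_interior_derived; apply/seteqP; split.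
  exact/interiorS/weak_star_derived_sub.
rewrite -(convex_interior_closure cD D0); apply: interiorS.
have UD : U `<=` closure D.
  exact: subset_trans (@subset_weak_star_derived _ _ _ _) (@subset_closure _ _).
apply: subset_trans (weak_star_closureS UD) _.
apply: krein_smulian; first exact: convex_closure.
(* The contraction of [f] towards [u] lies in the envelope of [interior D], which is
   [envelope (envelope U)], hence in [D] by the hypothesis; then [s] tends to 0. *)
move=> M f clf; have [u Du] := D0; apply: closed_closure.
apply: (limit_toward (u := u)) => s s0 s1; apply: subset_closure.
apply: interior_subset; rewrite -envelope_interior_derived -UU envelope_interior_derived.
by apply: (envelope_contract (M := M) cD Du _ _ clf) => // g [].
Qed.

(** The second envelope is open and stays within [weak_star_closure U]. *)
Lemma interior_envelope_idem : envelope U = interior (weak_star_closure U) ->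
  envelope (envelope U) = envelope U.
Proof.
move=> UI; apply/seteqP; split; last exact/subset_envelope/envelope_open.
rewrite [X in _ `<=` X]UI -open_subsetE; last exact: envelope_open.
apply: subset_trans (@envelope_sub_derived _ _ _ _) _.
apply: subset_trans (@weak_star_derived_sub _ _ _ _) _.
rewrite -[X in _ `<=` X]weak_star_closure_id; apply: weak_star_closureS.
by rewrite UI; exact: interior_subset.
Qed.

(** A convex set with interior points lies in the norm closure of its interior, and its norm closure
    has no larger interior: the first fact gives (iv) from (iii), the second (iii) from (iv). *)
Lemma interior_closure_iff : envelope U = interior (weak_star_closure U) <->
  weak_star_closure U = closure D.
Proof.
have cU : convex_set (weak_star_closure U) by exact: convex_weak_star_closure.
rewrite envelope_interior_derived; split=> [DI|->]; last first.
  by rewrite convex_interior_closure.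
apply/seteqP; split.
  have I0 : interior (weak_star_closure U) !=set0 by rewrite -DI; exact: D0.
  apply: subset_trans (convex_closure_interior cU I0) _.
  by rewrite -DI; apply: closureS; exact: interior_subset.
apply: subset_trans (closureS (@weak_star_derived_sub _ _ _ _)) _.
rewrite -[X in _ `<=` X]weak_star_closure_id; exact: norm_closure_weak_star.
Qed.

End Equivalences.

Theorem theorem3p1 (R : realType) (k : scalar_kind)
    (X : completeNormedModType (scalars R k)) (U : set (dual X))
    (U_open : open U) (U_convex : convex_set U) :
  [/\ envelope U = interior (weak_star_derived U),
      forall (d : Order.disp_t) (W : orderType d)
        (wf : well_founded (fun v w : W => (v < w)%O)) (alpha : W),
        transfinite wf envelope U alpha =
        interior (transfinite wf weak_star_derived U alpha)
    & let i := boundedly_regular U in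
      let ii := envelope (envelope U) = envelope U in
      let iii := envelope U = interior (weak_star_closure U) in
      let iv := weak_star_closure U = closure (weak_star_derived U) in
      [/\ ii <-> iii, iii <-> iv & i -> ii] ].
Proof.
(* The empty set is treated apart, as the contractions need a point of [U]. *)
have [->|/set0P U0] := eqVneq U set0.
  split=> [|d W wf w|].
  - by rewrite envelope0 weak_star_derived0 interior0.
  - by rewrite !transfinite0 ?interior0//; [exact: weak_star_derived0|exact: envelope0].
  - by rewrite /= !envelope0 weak_star_derived0 weak_star_closure0 interior0 closure0.
split=> [|d W wf w|].
- exact: envelope_interior_derived.
- exact: transfinite_envelope.
split; [split| |].
- exact: envelope_idem_interior.
- exact: interior_envelope_idem.
- exact: interior_closure_iff.
- exact: boundedly_regular_envelope.
Qed.
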